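(* Let $f:\mathbb{C}\to\mathbb{C}$ be a transcendental entire function, let $R>0$ be such that $M(r,f)>r$ for all $r\ge R$, and let $A_R(f)$ be a spider's web. (a) Each point in $I(f)$ belongs to an unbounded continuum in $I(f)$ on which all points escape to infinity uniformly. (b) If $K$ is a connected component of $A(f)^c=\mathbb{C}\setminus A(f)$, then either $K\cap I(f)=\emptyset$ or all points in $K$ escape to infinity uniformly.
   Context: $\mathbb{N}=\{1,2,\dots\}$; $f^n$ denotes the $n$th iterate of $f$. The escaping set is $I(f)=\{z: f^n(z)\to\infty\text{ as } n\to\infty\}$. $M(r,f)=\max_{|z|=r}|f(z)|$ for $r>0$, and $M^n(r,f)$ denotes the $n$th iterate of $r\mapsto M(r,f)$. $A_R(f)=\{z: |f^n(z)|\ge M^n(R,f)\text{ for all } n\in\mathbb{N}\}$. The fast escaping set is $A(f)=\{z:\text{there exists } L\in\mathbb{N}\text{ such that } |f^{n+L}(z)|\ge M^n(R,f)\text{ for all } n\in\mathbb{N}\}$; it does not depend on the choice of $R$ with $M(r,f)>r$ for $r\ge R$. A set $E\subset\mathbb{C}$ is a spider's web if $E$ is connected and there exists a sequence of bounded simply connected domains $G_n$, $n\in\mathbb{N}$, with $G_n\subset G_{n+1}$ and $\partial G_n\subset E$ for all $n\in\mathbb{N}$, and $\bigcup_{n\in\mathbb{N}}G_n=\mathbb{C}$. An unbounded continuum is an unbounded closed connected subset of $\mathbb{C}$. All points of a set $C$ escape to infinity uniformly if $f^n\to\infty$ uniformly on $C$, i.e. $\inf_{z\in C}|f^n(z)|\to\infty$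 as $n\to\infty$. *)

(* Defs.v *)
From HB Require Import structures.
From mathcomp Require Import all_boot all_order all_algebra.
From mathcomp Require Import complex.
From mathcomp Require Import all_classical all_reals all_analysis.

Set Implicit Arguments.
Unset Strict Implicit.
Unset Printing Implicit Defensive.

Import Order.TTheory GRing.Theory Num.Theory.
Import numFieldNormedType.Exports.

Local Open Scope classical_set_scope.
Local Open Scope ring_scope.

(* The complex plane over a [realType] is [R[i]^o]: the [^o] gives [R[i]] the
   normed-module structure, hence the topology, of a field over itself.  The
   norm [`|z|] of MathComp is then [R[i]]-valued; [cmod] is the real modulus. *)
Notation Cplane R := (complex R)^o.

Definition cmod (R : realType) (z : Cplane R) : R := complex.Re `|z|.

Section EntireFunctions.
Context {R : realType}.
Implicit Types (f : Cplane R -> Cplane R).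

(* [derivable] in the direction 1 over the scalar field [R[i]] is the
   existence of the limit of the complex difference quotient. *)
Definition entire f : Prop := forall z, derivable f z 1.

Definition transcendental_entire f : Prop :=
  entire f /\ ~ exists p : {poly complex R}, forall z, f z = p.[z].

(* For continuous [f] and [0 <= r] the supremum is attained. *)
Definition max_modulus f (r : R) : R :=
  sup [set cmod (f z) | z in [set z | cmod z = r]].

Definition max_modulus_iter f (n : nat) (r : R) : R :=
  iter n (max_modulus f) r.

Definition escaping_set f : set (Cplane R) :=
  [set z | cmod (iter n f z) @[n --> \oo] --> +oo].

Definition A_level f (r : R) : set (Cplane R) :=
  [set z | forall n, (0 < n)%N ->
     max_modulus_iter f n r <= cmod (iter n f z)].

(* The dependence on [r] is only apparent as soon as [s < max_modulus f s] for
   all [s >= r]. *)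
Definition fast_escaping_set f (r : R) : set (Cplane R) :=
  [set z | exists2 L, (0 < L)%N & forall n, (0 < n)%N ->
     max_modulus_iter f n r <= cmod (iter (n + L) f z)].

(* The infimum is taken in [\bar R]. *)
Definition escape_uniformly f (C : set (Cplane R)) : Prop :=
  ereal_inf [set (cmod (iter n f z))%:E | z in C] @[n --> \oo] --> +oo%E.

End EntireFunctions.

Section PlaneTopology.
Context {R : realType}.
Implicit Types (E G C K : set (Cplane R)).

Definition boundary E : set (Cplane R) := closure E `\` interior E.

Definition domain G : Prop := [/\ G !=set0, open G & connected G].

Definition loop_in G (g : R -> Cplane R) : Prop :=
  [/\ {within `[0, 1], continuous g}, g 0 = g 1 &
      forall t, t \in `[0, 1] -> G (g t)].

(* The endpoints of the loop stay fixed; [s] is the deformation parameter of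
   [H (s, t)]. *)
Definition null_homotopic_in G (g : R -> Cplane R) : Prop :=
  exists H : R * R -> Cplane R,
    [/\ {within `[0, 1] `*` `[0, 1], continuous H},
        forall s t, s \in `[0, 1] -> t \in `[0, 1] -> G (H (s, t)),
        forall t, t \in `[0, 1] -> H (0, t) = g t,
        forall t, t \in `[0, 1] -> H (1, t) = g 0 &
        forall s, s \in `[0, 1] -> H (s, 0) = g 0 /\ H (s, 1) = g 0].

Definition simply_connected_domain G : Prop :=
  domain G /\ forall g, loop_in G g -> null_homotopic_in G g.

Definition spiders_web E : Prop :=
  connected E /\
  exists G : nat -> set (Cplane R),
    [/\ forall n, bounded_set (G n) /\ simply_connected_domain (G n),
        forall n, G n `<=` G n.+1,
        forall n, boundary (G n) `<=` E &
        \bigcup_n G n = setT].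

Definition unbounded_continuum C : Prop :=
  [/\ ~ bounded_set C, closed C & connected C].

Definition component_of E K : Prop :=
  exists2 z, E z & K = connected_component E z.

End PlaneTopology.

(* Main.v *)
Require Import Defs.
From mathcomp Require Import all_boot all_order all_algebra.
From mathcomp Require Import complex ring lra.
From mathcomp Require Import all_classical all_reals all_analysis.
Set Implicit Arguments.
Unset Strict Implicit.
Unset Printing Implicit Defensive.
Import Order.TTheory GRing.Theory Num.Theory.
Import numFieldNormedType.Exports.
Local Open Scope classical_set_scope.
Local Open Scope ring_scope.

(** Part (b): an iterate of a connected subset of the complement of [A(f)]
    misses every boundary of [G n], so it lies outside [G n] as soon as one of
    its points does.

    Part (a): let [X n] be the closure of [f^n(A_R(f))], a decreasing sequence
    of unbounded connected sets with [f (X n)] contained in [X (n+1)] and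
    leaving every disc.  If some [f^n] has no zero, the minimum principle for
    [f^k] on the [G j] gives [|f^k| >= M^k(R)] on the whole plane for large [k].
    Otherwise the open sets [B n = f^n(G (k n)) \ X n], with [k n] so large that
    [f^n] has a zero in [G (k n)], are bounded, have boundary in [X n], and
    contain any given disc for large [n].  Given an escaping point, choose
    [m(n)] tending to infinity slowly enough that the orbit avoids [B (m(n))] at
    time [n]; the points sharing this property escape uniformly and form a
    closed set no component of which is bounded.

    The only complex analysis needed is the minimum principle for differentiable
    maps.  It follows from the mean value property over circles, which is
    Goursat's lemma for [k o exp] on a rectangle of height [2 pi]. *)

(** * Modulus and topology of the plane *)


Section Modulus.
Context {R : realType}.
Local Notation C := (Cplane R).
Implicit Types (z w : C) (x y : R).

Lemma cmodE z : cmod z = Num.sqrt (complex.Re z ^+ 2 + complex.Im z ^+ 2).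
Proof. by rewrite /cmod normc_def. Qed.

Lemma normC_cmod z : `|z| = (cmod z)%:C%C.
Proof. by rewrite cmodE normc_def. Qed.

Lemma cmod_ge0 z : 0 <= cmod z.
Proof. by rewrite cmodE sqrtr_ge0. Qed.

Lemma cmodM z w : cmod (z * w) = cmod z * cmod w.
Proof. by apply: complexI; rewrite rmorphM -!normC_cmod normrM. Qed.

Lemma cmodV z : cmod z^-1 = (cmod z)^-1.
Proof. by apply: complexI; rewrite fmorphV -!normC_cmod normfV. Qed.

Lemma cmodBC z w : cmod (z - w) = cmod (w - z).
Proof. by rewrite /cmod distrC. Qed.

Lemma cmod0 : cmod (0 : C) = 0.
Proof. by rewrite /cmod normr0. Qed.

Lemma cmod_eq0 z : (cmod z == 0) = (z == 0).
Proof. by rewrite -(normr_eq0 z) normC_cmod -(inj_eq (@complexI R)). Qed.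

Lemma cmod_gt0 z : (0 < cmod z) = (z != 0).
Proof. by rewrite lt_def cmod_ge0 andbT cmod_eq0. Qed.

Lemma cmodD z w : cmod (z + w) <= cmod z + cmod w.
Proof. by rewrite -lecR rmorphD -!normC_cmod ler_normD. Qed.

Lemma cmod_triangle (v z w : C) : cmod (z - w) <= cmod (z - v) + cmod (v - w).
Proof. by rewrite -[z - w](subrKA v) cmodD. Qed.

Lemma cmod_Re z : `|complex.Re z| <= cmod z.
Proof. by rewrite -lecR -normC_cmod normc_ge_Re. Qed.

Lemma cmod_real x : cmod (x%:C%C : C) = `|x|.
Proof. by rewrite cmodE /= expr0n addr0 sqrtr_sqr. Qed.

Lemma cmod_Im z : `|complex.Im z| <= cmod z.
Proof.
by rewrite cmodE -sqrtr_sqr ler_sqrt ?lerDr ?sqr_ge0// addr_ge0// sqr_ge0.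
Qed.

Lemma cmod_le_ReIm z : cmod z <= `|complex.Re z| + `|complex.Im z|.
Proof.
rewrite [z in cmod z]complexE (le_trans (cmodD _ _))// cmodM !cmod_real.
by rewrite cmodE /= expr0n add0r expr1n sqrtr1 mul1r.
Qed.

(** Balls of [R[i]] have complex radii, but a positive complex number is real, so real radii for
    [cmod] give the same neighbourhoods. *)
Lemma nbhs_cmodP z (A : set C) :
  nbhs z A <-> exists2 e : R, 0 < e & forall w, cmod (w - z) < e -> A w.
Proof.
split.
  move=> /nbhs_ballP[e /= e0 h]; move: e0; rewrite ltcE /= => /andP[/eqP im0 re0].
  exists (complex.Re e) => // w hw; apply: h; rewrite -ball_normE /=.
  by rewrite distrC normC_cmod ltcE /= im0 eqxx.
move=> [e e0 h]; apply/nbhs_ballP; exists (e%:C%C) => /=; first by rewrite ltcR.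
by move=> w; rewrite -ball_normE /= distrC normC_cmod ltcR; exact: h.
Qed.

Lemma continuous_cmodP (f : C -> C) z : {for z, continuous f} <->
  forall e : R, 0 < e -> exists2 d : R, 0 < d &
    forall w, cmod (w - z) < d -> cmod (f w - f z) < e.
Proof.
split=> [cf e e0|h A /nbhs_cmodP[e e0 eA]].
  have /cf/nbhs_cmodP[d d0 dh] : nbhs (f z) [set w | cmod (w - f z) < e].
    by apply/nbhs_cmodP; exists e.
  by exists d.
have [d d0 dh] := h e e0.
by apply/nbhs_cmodP; exists d => // w /dh /eA.
Qed.

Lemma open_cmodP (A : set C) : open A <->
  forall z, A z -> exists2 e : R, 0 < e & forall w, cmod (w - z) < e -> A w.
Proof.
rewrite openE; split=> h z Az; have := h z Az.
  by move=> /nbhs_cmodP.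
by move=> ?; apply/nbhs_cmodP.
Qed.

Lemma bounded_cmodP (A : set C) :
  bounded_set A <-> exists M : R, forall z, A z -> cmod z <= M.
Proof.
split=> [[M [Mr h]]|[M h]].
  exists (complex.Re (M + 1)) => z Az.
  have /h /(_ z Az) : M < M + 1 by rewrite ltrDl.
  by rewrite /= normC_cmod lecE => /andP[].
exists M%:C%C; split; first by apply/complex_realP; exists M.
move=> e Me z Az /=; rewrite normC_cmod (le_trans _ (ltW Me))// lecR.
exact: h.
Qed.

Lemma bounded_cmod_pos (A : set C) :
  bounded_set A -> exists2 M : R, 0 < M & forall z, A z -> cmod z < M.
Proof.
move=> /bounded_cmodP[M h]; exists (`|M| + 1); first by rewrite ltr_wpDl.
by move=> z /h /le_lt_trans; apply; rewrite (le_lt_trans (ler_norm _))// ltrDl.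
Qed.

Lemma continuous_Re : continuous (@complex.Re R : C -> R).
Proof.
move=> z A /nbhs_ballP[e /= e0 eA]; apply/nbhs_cmodP; exists e => // w hw.
apply: eA; rewrite /ball /= distrC; apply: le_lt_trans hw.
by rewrite (le_trans _ (cmod_Re _))// raddfB.
Qed.

Lemma continuous_cmod : continuous (@cmod R).
Proof.
move=> z A /nbhs_ballP[e /= e0 eA]; apply/nbhs_cmodP; exists e => // w hw.
apply: eA; rewrite /ball /= distrC; apply: le_lt_trans hw.
have := cmodD (w - z) z; have := cmodD (z - w) w.
by rewrite !subrK cmodBC ler_norml; lra.
Qed.

Lemma continuous_Complex :
  continuous (fun u : R * R => (Complex u.1 u.2 : C)).
Proof.
move=> [x y] A /nbhs_cmodP[e e0 eA].
have e20 : 0 < e / 2 by rewrite divr_gt0.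
apply/nbhs_ballP; exists (e / 2) => //= -[x' y'] [/= hx hy]; apply: eA.
apply: le_lt_trans (cmod_le_ReIm _) _; rewrite /= (splitr e).
by rewrite ltrD// -/(_ - _) distrC.
Qed.

(** Heine-Borel, carried over from the square [[-M, M]^2] by the continuous map [Complex]. *)
Lemma compact_bounded_closed (A : set C) :
  bounded_set A -> closed A -> compact A.
Proof.
move=> /bounded_cmodP[M h] cA.
pose Q := ([set` `[-M, M]] `*` [set` `[-M, M]]) : set (R * R).
have cQ : compact Q.
  by apply: compact_setX; exact: segment_compact.
apply: (subclosed_compact cA (B := (fun u : R * R => Complex u.1 u.2 : C) @` Q)).
  apply: continuous_compact cQ; apply: continuous_subspaceT.
  exact: continuous_Complex.
move=> z Az; exists (complex.Re z, complex.Im z); last by case: z {Az}.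
by split; rewrite /= in_itv /= -ler_norml (le_trans _ (h _ Az))//
  ?cmod_Re// cmod_Im.
Qed.

Lemma closure_cmodP (A : set C) z : closure A z <->
  forall e : R, 0 < e -> exists2 w, A w & cmod (w - z) < e.
Proof.
split=> [h e e0|h B /nbhs_cmodP[e e0 eB]].
  have /h[w [Aw hw]] : nbhs z [set w | cmod (w - z) < e].
    by apply/nbhs_cmodP; exists e.
  by exists w.
by have [w Aw /eB Bw] := h e e0; exists w.
Qed.

Lemma closure_bounded (A : set C) : bounded_set A -> bounded_set (closure A).
Proof.
move=> /bounded_cmodP[M h]; apply/bounded_cmodP; exists (M + 1) => z.
move=> /closure_cmodP/(_ _ ltr01)[w Aw hw].
rewrite -(subrK w z) (le_trans (cmodD _ _))// addrC lerD ?h//.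
by rewrite cmodBC ltW.
Qed.

Lemma compact_closure (A : set C) : bounded_set A -> compact (closure A).
Proof.
move=> bA; apply: compact_bounded_closed; last exact: closed_closure.
exact: closure_bounded.
Qed.

Lemma compact_bounded_set (A : set C) : compact A -> bounded_set A.
Proof.
have [->|/set0P A0] := eqVneq A set0; first by move=> _; apply/bounded_cmodP; exists 0.
move=> cA; have [|c _ hc] := compact_EVT_max A0 cA (f := @cmod R).
  exact/continuous_subspaceT/continuous_cmod.
by apply/bounded_cmodP; exists (cmod c) => z Az; apply: hc; rewrite inE.
Qed.

End Modulus.

(** * Goursat's lemma *)


Section Bisection.
Context {R : realType}.

Definition half (i : bool) (I : R * R) : R * R :=
  let m := (I.1 + I.2) / 2 in if i then (m, I.2) else (I.1, m).

(** The left endpoints increase and stay below every right endpoint, so their supremum is a common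
    point. *)
Lemma nested_halves (I : nat -> R * R) :
  (I 0%N).1 <= (I 0%N).2 -> (forall n, exists i, I n.+1 = half i (I n)) ->
  (forall n, [/\ (I 0%N).1 <= (I n).1, (I n).2 <= (I 0%N).2 &
     (I n).2 - (I n).1 = ((I 0%N).2 - (I 0%N).1) / 2 ^+ n]) /\
  exists x, forall n, (I n).1 <= x <= (I n).2.
Proof.
move=> I0 step.
have len n : (I n).2 - (I n).1 = ((I 0%N).2 - (I 0%N).1) / 2 ^+ n.
  elim: n => [|n IH]; first by rewrite expr0 divr1.
  have [i ->] := step n; rewrite exprS invfM mulrCA -IH.
  by case: i => /=; lra.
have le n : (I n).1 <= (I n).2.
  by rewrite -subr_ge0 len divr_ge0// ?subr_ge0// exprn_ge0.
have mon n : (I n).1 <= (I n.+1).1 /\ (I n.+1).2 <= (I n).2.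
  by have [i ->] := step n; have := le n; case: i => /= ?; split; lra.
have mono m k : (I m).1 <= (I (m + k)%N).1 /\ (I (m + k)%N).2 <= (I m).2.
  elim: k => [|k [IH1 IH2]]; first by rewrite addn0.
  by have [h1 h2] := mon (m + k)%N; rewrite addnS; split;
    [exact: le_trans h1|exact: le_trans IH2].
split; first by move=> n; have [] := mono 0%N n; rewrite add0n.
pose A := [set (I n).1 | n in [set: nat]].
have ub m : ubound A (I m).2.
  move=> _ [n _ <-]; have [h1 _] := mono n m; have [_ h2] := mono m n.
  by rewrite addnC in h2; exact: le_trans h1 (le_trans (le _) h2).
have sA : has_sup A by split; [exists (I 0%N).1, 0%N|exists (I 0%N).2].
exists (sup A) => n; apply/andP; split.
  by apply: ub_le_sup; [exact: sA.2|exists n].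
by apply: ge_sup; [exact: sA.1|exact: ub].
Qed.

(** The bisection behind Goursat's lemma. By additivity some quarter of a rectangle keeps at least a
    quarter of [|Phi|]; after [n] steps the factor [4 ^ n] is cancelled by the squared size
    [(L / 2 ^ n) ^ 2]. *)
Lemma rectangle_fun_eq0 (Phi : R -> R -> R -> R -> R) (a0 b0 c0 d0 : R) :
  a0 <= b0 -> c0 <= d0 ->
  (forall a m b c d, Phi a b c d = Phi a m c d + Phi m b c d) ->
  (forall a b c m d, Phi a b c d = Phi a b c m + Phi a b m d) ->
  (forall x y, a0 <= x <= b0 -> c0 <= y <= d0 -> forall e, 0 < e ->
    exists2 r, 0 < r & forall a b c d,
      a0 <= a -> a <= x <= b -> b <= b0 -> c0 <= c -> c <= y <= d -> d <= d0 ->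
      b - a < r -> d - c < r ->
      `|Phi a b c d| <= e * ((b - a) + (d - c)) ^+ 2) ->
  Phi a0 b0 c0 d0 = 0.
Proof.
move=> ab cd splitx splity small.
pose P (Q : (R * R) * (R * R)) := Phi Q.1.1 Q.1.2 Q.2.1 Q.2.2.
have pick (Q : (R * R) * (R * R)) :
    {ij : bool * bool | `|P Q| <= 4 * `|P (half ij.1 Q.1, half ij.2 Q.2)|}.
  apply: cid; apply: contrapT => /forallNP bad.
  set m := (Q.1.1 + Q.1.2) / 2; set n := (Q.2.1 + Q.2.2) / 2.
  have h i j : 4 * `|P (half i Q.1, half j Q.2)| < `|P Q|.
    by rewrite ltNge; apply/negP; exact: (bad (i, j)).
  have := h false false; have := h false true; have := h true false.
  have := h true true; rewrite /P /half /= -/m -/n.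
  rewrite (splitx Q.1.1 m Q.1.2 Q.2.1 Q.2.2) (splity Q.1.1 m Q.2.1 n Q.2.2).
  rewrite (splity m Q.1.2 Q.2.1 n Q.2.2).
  move: (Phi m _ n _) (Phi m _ _ n) => u v.
  move: (Phi _ m n _) (Phi _ m _ n) => t w.
  have := ler_normD (w + t) (v + u); have := ler_normD w t.
  have := ler_normD v u; lra.
pose step Q := let ij := sval (pick Q) in (half ij.1 Q.1, half ij.2 Q.2).
pose Q n := iter n step ((a0, b0), (c0, d0)).
have big n : `|P (Q 0%N)| <= 4 ^+ n * `|P (Q n)|.
  elim: n => [|n IH]; first by rewrite expr0 mul1r.
  apply: le_trans IH _; rewrite exprSr -mulrA ler_wpM2l ?exprn_ge0//.
  exact: svalP (pick (Q n)).
have [||lx [x hx]] := @nested_halves (fun n => (Q n).1).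
- exact: ab.
- by move=> n; exists (sval (pick (Q n))).1.
have [||ly [y hy]] := @nested_halves (fun n => (Q n).2).
- exact: cd.
- by move=> n; exists (sval (pick (Q n))).2.
rewrite /= in lx ly hx hy.
set L := (b0 - a0) + (d0 - c0).
have L0 : 0 <= L by rewrite addr_ge0// subr_ge0.
suff : `|P (Q 0%N)| <= 0 by rewrite normr_le0 => /eqP.
apply/ler_addgt0Pr => e e0; rewrite add0r.
(* The summand 1 keeps the denominator positive when the rectangle degenerates to a point. *)
pose e' := e / (L ^+ 2 + 1).
have L21 : 0 < L ^+ 2 + 1 by rewrite ltr_wpDl ?sqr_ge0.
have e'0 : 0 < e' by rewrite divr_gt0.
have [r r0 hr] := small x y (hx 0%N) (hy 0%N) e' e'0.
have [n hn] : exists n, L / 2 ^+ n < r.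
  have /cvgrPdist_lt/(_ r r0)[n _ /(_ n (leqnn n)) /=] :
    L / 2 ^+ k @[k --> \oo] --> 0.
    under eq_fun do rewrite -exprVn.
    by apply: cvg_geometric; rewrite ger0_norm ?invr_ge0// invf_lt1// ltr1n.
  rewrite sub0r normrN ger0_norm; first by exists n.
  by rewrite divr_ge0// exprn_ge0.
have p2 : 0 < (2 : R) ^+ n by rewrite exprn_gt0.
have [x1 x2 x3] := lx n; have [y1 y2 y3] := ly n.
apply: le_trans (big n) _.
have hQ : `|P (Q n)| <= e' * (L / 2 ^+ n) ^+ 2.
  apply: le_trans (hr _ _ _ _ x1 (hx n) x2 y1 (hy n) y2 _ _) _.
  - rewrite x3; apply: le_lt_trans hn; rewrite ler_pM2r ?invr_gt0//.
    by rewrite /L lerDl subr_ge0.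
  - rewrite y3; apply: le_lt_trans hn; rewrite ler_pM2r ?invr_gt0//.
    by rewrite /L lerDr subr_ge0.
  - by rewrite x3 y3 -mulrDl.
apply: le_trans (ler_wpM2l (exprn_ge0 _ _) hQ) _ => //.
have -> : 4 ^+ n * (e' * (L / 2 ^+ n) ^+ 2) = e' * L ^+ 2.
  have -> : (4 : R) = 2 ^+ 2 by rewrite expr2 -natrM.
  by rewrite -exprM mulnC exprM; field; rewrite gt_eqF.
by rewrite /e' mulrAC ler_pdivrMr// ler_wpM2l// ?ltW// ltrDl.
Qed.

End Bisection.

Section Goursat.
Context {R : realType}.

(** The derivative is obtained at interior points only, so this is applied on intervals slightly
    larger than the ones of interest. *)
Lemma exists_primitive (g : R -> R) (a b : R) :
  (forall x, a <= x <= b -> {for x, continuous g}) ->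
  exists G : R -> R, forall x, a < x < b -> is_derive x 1 G (g x).
Proof.
move=> cg.
exists (fun x => \int[lebesgue_measure]_(t in [set` `[a, x]]) g t).
move=> x /andP[ax xb].
have ig : lebesgue_measure.-integrable `[a, b] (EFin \o g).
  apply: continuous_compact_integrable; first exact: segment_compact.
  apply: continuous_in_subspaceT => t; rewrite inE /= in_itv /=; exact: cg.
have [] := @continuous_FTC1_closed R g a x b xb ig ax.
  by apply: cg; rewrite !ltW.
by rewrite derive1E => d1 d2; exact: DeriveDef d1 d2.
Qed.

Lemma is_derive_MVT (h dh : R -> R) (a b : R) : a <= b ->
  (forall x, a <= x <= b -> is_derive x 1 h (dh x)) ->
  exists2 c, a <= c <= b & h b - h a = dh c * (b - a).
Proof.
move=> ab hd.
have [] := @MVT_segment R h dh a b ab.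
- move=> x; rewrite in_itv /= => /andP[ax xb]; apply: hd.
  by rewrite !ltW.
- apply: derivable_within_continuous => x; rewrite in_itv /= => axb.
  by have [] := hd x axb.
by move=> c; rewrite in_itv /= => cab E; exists c.
Qed.

Lemma is_derive_osc (h dh : R -> R) (a b e : R) : a <= b ->
  (forall x, a <= x <= b -> is_derive x 1 h (dh x)) ->
  (forall x, a <= x <= b -> `|dh x| <= e) -> `|h b - h a| <= e * (b - a).
Proof.
move=> ab hd he; have [c cab ->] := is_derive_MVT ab hd.
rewrite normrM [X in _ * X]ger0_norm ?subr_ge0// ler_wpM2r ?subr_ge0//.
exact: he.
Qed.

(** Complex differentiability of [U + iV] with derivative [al + i be], split into real and imaginary
    parts; the Cauchy-Riemann equations are the sharing of [al] and [be]. *)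
Definition CR_diff (U V : R -> R -> R) (x y : R) := exists al be : R,
  forall e, 0 < e -> exists2 r, 0 < r & forall s t,
    `|s - x| < r -> `|t - y| < r ->
    `|U s t - U x y - (al * (s - x) - be * (t - y))|
       <= e * (`|s - x| + `|t - y|) /\
    `|V s t - V x y - (be * (s - x) + al * (t - y))|
       <= e * (`|s - x| + `|t - y|).

(* [\int U dy + V dx] along the boundary of a rectangle, the integrals being
   given by primitives. *)
Lemma goursat (U V UP VP : R -> R -> R) (a0 b0 c0 d0 : R) :
  a0 <= b0 -> c0 <= d0 ->
  (forall x y, a0 <= x <= b0 -> c0 <= y <= d0 -> CR_diff U V x y) ->
  (forall x y, a0 <= x <= b0 -> c0 <= y <= d0 -> is_derive y 1 (UP x) (U x y)) ->
  (forall x y, a0 <= x <= b0 -> c0 <= y <= d0 -> is_derive x 1 (VP y) (V x y)) ->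
  (UP b0 d0 - UP b0 c0) - (UP a0 d0 - UP a0 c0)
  + (VP c0 b0 - VP c0 a0) - (VP d0 b0 - VP d0 a0) = 0.
Proof.
move=> ab cd cr dU dV.
apply: (@rectangle_fun_eq0 _ (fun a b c d =>
  (UP b d - UP b c) - (UP a d - UP a c)
  + (VP c b - VP c a) - (VP d b - VP d a))) => //.
- by move=> *; ring.
- by move=> *; ring.
move=> x y hx hy e e0; have [al [be small]] := cr x y hx hy.
have e4 : 0 < e / 4 by rewrite divr_gt0.
have [r r0 hr] := small _ e4.
exists r => // a b c d a0a /andP[ax xb] bb0 c0c /andP[cy yd] dd0 lab lcd.
have inx s : a <= s <= b -> a0 <= s <= b0.
  by move=> /andP[h1 h2]; rewrite (le_trans a0a)// (le_trans h2).
have iny s : c <= s <= d -> c0 <= s <= d0.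
  by move=> /andP[h1 h2]; rewrite (le_trans c0c)// (le_trans h2).
set L := (b - a) + (d - c).
have near s t : a <= s <= b -> c <= t <= d ->
    [/\ `|s - x| < r, `|t - y| < r & `|s - x| + `|t - y| <= L].
  move=> /andP[as_ sb] /andP[ct td].
  have h1 : `|s - x| <= b - a by rewrite ler_norml; lra.
  have h2 : `|t - y| <= d - c by rewrite ler_norml; lra.
  by split; [lra|lra|rewrite /L; lra].
have sab : a <= b by lra.
have scd : c <= d by lra.
have bab : a <= b <= b by rewrite sab lexx.
have aab : a <= a <= b by rewrite sab lexx.
have ccd : c <= c <= d by rewrite scd lexx.
have dcd : c <= d <= d by rewrite scd lexx.
(* The two points compared share a coordinate, so [be] drops out here and in [estV]. *)
have estU t : c <= t <= d -> `|U b t - U a t - al * (b - a)| <= e / 2 * L.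
  move=> ht; have [r1 r2 r3] := near b t bab ht.
  have [r4 r5 r6] := near a t aab ht.
  have [+ _] := hr b t r1 r2; have [+ _] := hr a t r4 r5.
  have l1 := ler_wpM2l (ltW e4) r3; have l2 := ler_wpM2l (ltW e4) r6.
  by move: l1 l2; rewrite !ler_norml => *; lra.
have estV s : a <= s <= b -> `|V s c - V s d + al * (d - c)| <= e / 2 * L.
  move=> hs; have [r1 r2 r3] := near s c hs ccd.
  have [r4 r5 r6] := near s d hs dcd.
  have [_ +] := hr s c r1 r2; have [_ +] := hr s d r4 r5.
  have l1 := ler_wpM2l (ltW e4) r3; have l2 := ler_wpM2l (ltW e4) r6.
  by move: l1 l2; rewrite !ler_norml => *; lra.
(* Integrated along the sides, the main terms of [IU] and [IV] are [al * (b - a) * (d - c)] with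
   opposite signs; they cancel in the sum. *)
have IU : `|(UP b d - UP a d - al * (b - a) * d)
            - (UP b c - UP a c - al * (b - a) * c)| <= e / 2 * L * (d - c).
  apply: (@is_derive_osc (fun t => UP b t - UP a t - al * (b - a) * t)
    (fun t => U b t - U a t - al * (b - a))) => // t ht.
  have := dU b t (inx b bab) (iny t ht); have := dU a t (inx a aab) (iny t ht).
  move=> h1 h2; apply: is_deriveB; apply: is_derive_eq.
  by rewrite /GRing.scale /= mulr1.
have IV : `|(VP c b - VP d b + al * (d - c) * b)
            - (VP c a - VP d a + al * (d - c) * a)| <= e / 2 * L * (b - a).
  apply: (@is_derive_osc (fun t => VP c t - VP d t + al * (d - c) * t)
    (fun t => V t c - V t d + al * (d - c))) => // t ht.
  have := dV t c (inx t ht) (iny c ccd); have := dV t d (inx t ht) (iny d dcd).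
  move=> h1 h2; apply: is_deriveD; apply: is_derive_eq.
  by rewrite /GRing.scale /= mulr1.
have -> : e * L ^+ 2 = e / 2 * L * (d - c) + e / 2 * L * (b - a)
                     + e / 2 * L * L by rewrite /L; field.
apply: (@le_trans _ _ (e / 2 * L * (d - c) + e / 2 * L * (b - a))).
  apply: le_trans (lerD IU IV); apply: le_trans (ler_normD _ _).
  by rewrite le_eqVlt; apply/orP; left; apply/eqP; congr (`|_|); ring.
by rewrite lerDl mulr_ge0// ?mulr_ge0 ?(ltW e0)// ?divr_ge0 ?(ltW e0)// /L; lra.
Qed.

End Goursat.

(** * Complex derivatives and the exponential *)


Section ComplexDerivative.
Context {R : realType}.
Local Notation C := (Cplane R).
Implicit Types (F G : C -> C) (z w : C).

Lemma derivable_cmodP F z : derivable F z 1 <-> exists d : C,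
  forall e : R, 0 < e -> exists2 r : R, 0 < r & forall w, cmod (w - z) < r ->
    cmod (F w - F z - d * (w - z)) <= e * cmod (w - z).
Proof.
split=> [/cvg_ex[/= d hd]|[d hd]].
  exists d => e e0.
  have /hd : nbhs d [set w | cmod (w - d) < e].
    by apply/nbhs_cmodP; exists e.
  move=> /nbhs_cmodP[r r0 hr]; exists r => // w wr.
  have [->|wz] := eqVneq w z; first by rewrite !subrr mulr0 subr0 cmod0 mulr0.
  have /= := hr (w - z); rewrite subr0 => /(_ wr); rewrite subr_eq0 => /(_ wz).
  rewrite /GRing.scale /= mulr1 subrK => h.
  have wz0 : w - z != 0 by rewrite subr_eq0.
  have -> : F w - F z - d * (w - z) = ((w - z)^-1 * (F w - F z) - d) * (w - z).
    by rewrite mulrBl mulrAC mulVf// mul1r.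
  by rewrite cmodM ler_wpM2r ?cmod_ge0// ltW.
apply/cvg_ex; exists d => /= A /nbhs_cmodP[e e0 eA].
have e20 : 0 < e / 2 by rewrite divr_gt0.
have [r r0 hr] := hd _ e20.
apply/nbhs_cmodP; exists r => // h; rewrite subr0 => hh h0.
apply: eA; have := hr (h + z); rewrite addrK => /(_ hh).
rewrite /GRing.scale /= mulr1 => hle.
have -> : h^-1 * (F (h + z) - F z) - d = h^-1 * (F (h + z) - F z - d * h).
  have key (a b c : complex R) : a != 0 -> a^-1 * b - c = a^-1 * (b - c * a).
    by move=> a0; field.
  exact: key.
rewrite cmodM cmodV mulrC ltr_pdivrMr ?cmod_gt0//.
by apply: le_lt_trans hle _; rewrite ltr_pM2r ?cmod_gt0// ltr_pdivrMr// ltr_pMr// ltr1n.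
Qed.

Lemma derivable_continuous F z : derivable F z 1 -> {for z, continuous F}.
Proof. by move=> /derivable1_diffP /differentiable_continuous. Qed.

Lemma derivable_compose F G z :
  derivable G z 1 -> derivable F (G z) 1 -> derivable (F \o G) z 1.
Proof.
move=> /derivable1_diffP dG /derivable1_diffP dF.
by apply/derivable1_diffP; exact: (@differentiable_comp _ C C C G F z dG dF).
Qed.

Definition cexp z : C :=
  Complex (expR (complex.Re z) * cos (complex.Im z))
          (expR (complex.Re z) * sin (complex.Im z)).

Lemma cexpD z w : cexp (z + w) = cexp z * cexp w.
Proof.
apply/eqP; rewrite eq_complex /= !raddfD /= expRD cosD sinD.
by apply/andP; split; apply/eqP; ring.
Qed.

Lemma cmod_cexp z : cmod (cexp z) = expR (complex.Re z).
Proof.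
rewrite cmodE /= !exprMn -mulrDr cos2Dsin2 mulr1 sqrtr_sqr.
by rewrite ger0_norm ?expR_ge0.
Qed.

Lemma real_derive_bound (h : R -> R) (dh : R) : is_derive (0 : R) 1 h dh ->
  forall e : R, 0 < e -> exists2 r : R, 0 < r & forall x, `|x| < r ->
    `|h x - h 0 - dh * x| <= e * `|x|.
Proof.
move=> [/cvgP dcv <-] e e0; move: dcv.
move=> /cvgrPdist_le/(_ e e0)/nbhs_ballP[r /= r0 hr].
exists r => // x xr.
have [->|x0] := eqVneq x 0; first by rewrite subrr mulr0 subr0 normr0 mulr0.
have := hr x; rewrite /ball /= sub0r normrN => /(_ xr x0).
rewrite addr0 /GRing.scale /= mulr1 => hle.
have -> : h x - h 0 - 'D_1 h 0 * x =
   - (('D_1 h 0 - x^-1 * (h x - h 0)) * x) by field.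
by rewrite normrN normrM ler_wpM2r.
Qed.

(** The functional equation reduces the claim to the first-order expansion of [cexp] at 0, which
    follows from those of [expR], [cos] and [sin]. *)
Lemma derivable_cexp z : derivable cexp z 1.
Proof.
apply/derivable_cmodP; exists (cexp z) => e e0.
pose M := cmod (cexp z) + 1.
have M0 : 0 < M by rewrite ltr_wpDl ?cmod_ge0.
(* The 8 collects the errors below, in units of [c * N]: 1 from [t1], 2 from [t2], 4 from [t3] and 1
   from [hs]. *)
pose c := Num.min (e / (8 * M)) 1.
have c0 : 0 < c by rewrite lt_min ltr01 divr_gt0// mulr_gt0.
have c1 : c <= 1 by rewrite ge_min lexx orbT.
have ce : 8 * c * M <= e.
  have : c <= e / (8 * M) by rewrite ge_min lexx.
  by rewrite ler_pdivlMr ?mulr_gt0// mulrCA mulrA.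
clearbody c.
have [r1 r10 h1] := real_derive_bound (is_derive_expR 0) c0.
have [r2 r20 h2] := real_derive_bound (is_derive_cos 0) c0.
have [r3 r30 h3] := real_derive_bound (is_derive_sin 0) c0.
(* The bound [N < c] turns the second-order product in [t3] into a multiple of [c * N]. *)
exists (Num.min (Num.min r1 r2) (Num.min r3 c)).
  by rewrite !lt_min r10 r20 r30 c0 .
move=> w; rewrite !lt_min => /andP[/andP[w1 w2] /andP[w3 w4]].
set a := complex.Re (w - z); set b := complex.Im (w - z).
have la : `|a| <= cmod (w - z) := cmod_Re _.
have lb : `|b| <= cmod (w - z) := cmod_Im _.
have {}h1 := h1 a (le_lt_trans la w1); have {}h2 := h2 b (le_lt_trans lb w2).
have {}h3 := h3 b (le_lt_trans lb w3).
rewrite expR0 mul1r in h1; rewrite cos0 sin0 oppr0 mul0r subr0 in h2.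
rewrite sin0 cos0 mul1r subr0 in h3.
have -> : cexp w - cexp z - cexp z * (w - z) =
   cexp z * (cexp (w - z) - 1 - (w - z)).
  have -> : cexp w = cexp (w - z) * cexp z by rewrite -cexpD subrK.
  move: (cexp (w - z)) (cexp z) (w - z) => u v h.
  have key (u' v' h' : complex R) :
    u' * v' - v' - v' * h' = v' * (u' - 1 - h') by ring.
  exact: key.
rewrite cmodM; set N := cmod (w - z) in la lb w1 w2 w3 w4 *.
have N0 : 0 <= N := cmod_ge0 _.
suff hN : cmod (cexp (w - z) - 1 - (w - z)) <= 8 * c * N.
  apply: le_trans (ler_pM _ _ (_ : _ <= M) hN) _; rewrite ?cmod_ge0//.
    by rewrite lerDl.
  by rewrite mulrA ler_wpM2r// mulrC.
apply: le_trans (cmod_le_ReIm _) _.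
have -> : complex.Re (cexp (w - z) - 1 - (w - z)) =
   (expR a - 1 - a) * cos b + (1 + a) * (cos b - 1).
  rewrite /a /b; case: (w - z) => a' b' /=; ring.
have -> : complex.Im (cexp (w - z) - 1 - (w - z)) =
   (expR a - 1) * sin b + (sin b - b).
  rewrite /a /b; case: (w - z) => a' b' /=; ring.
have cb : `|cos b| <= 1 by rewrite ler_norml cos_geN1 cos_le1.
have cN : 0 <= c * N by rewrite mulr_ge0// ltW.
have ha : `|expR a - 1 - a| <= c * N.
  by apply: le_trans h1 _; rewrite ler_pM2l.
have hb : `|cos b - 1| <= c * N.
  by apply: le_trans h2 _; rewrite ler_pM2l.
have hs : `|sin b - b| <= c * N.
  by apply: le_trans h3 _; rewrite ler_pM2l.
have hc : c * N <= N by rewrite ler_piMl.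
have hs' : `|sin b| <= 2 * N.
  by have := ler_normD (sin b - b) b; rewrite subrK; lra.
have ha' : `|expR a - 1| <= 2 * N.
  by have := ler_normD (expR a - 1 - a) a; rewrite subrK; lra.
have h1a : `|1 + a| <= 2.
  by apply: le_trans (ler_normD _ _) _; rewrite normr1; lra.
have t1 : `|(expR a - 1 - a) * cos b| <= c * N * 1.
  by rewrite normrM ler_pM.
have t2 : `|(1 + a) * (cos b - 1)| <= 2 * (c * N).
  by rewrite normrM ler_pM.
have t3 : `|(expR a - 1) * sin b| <= 2 * c * (2 * N).
  rewrite normrM ler_pM//; apply: le_trans ha' _.
  by rewrite ler_pM2l// ltW.
have := ler_normD ((expR a - 1 - a) * cos b) ((1 + a) * (cos b - 1)).
by have := ler_normD ((expR a - 1) * sin b) (sin b - b); lra.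
Qed.

Lemma derivable_CR F (x y : R) : derivable F (Complex x y) 1 ->
  CR_diff (fun s t => complex.Re (F (Complex s t)))
          (fun s t => complex.Im (F (Complex s t))) x y.
Proof.
move=> /derivable_cmodP[[al be] hd]; exists al, be => e e0.
have [r r0 hr] := hd e e0.
have r20 : 0 < r / 2 by rewrite divr_gt0.
exists (r / 2) => // s t hs ht.
have E : (Complex s t - Complex x y : C) = Complex (s - x) (t - y) by [].
have hh : cmod (Complex s t - Complex x y : C) <= `|s - x| + `|t - y|.
  exact: cmod_le_ReIm.
have /hr h : cmod (Complex s t - Complex x y : C) < r.
  by apply: le_lt_trans hh _; lra.
have {}h := le_trans h (ler_wpM2l (ltW e0) hh).
split.
  apply: le_trans h; apply: le_trans (cmod_Re _); rewrite E.
  by case: (F _) (F _) => [u1 v1] [u2 v2].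
apply: le_trans h; apply: le_trans (cmod_Im _); rewrite E.
case: (F _) (F _) => [u1 v1] [u2 v2] /=.
by rewrite [al * _ + _]addrC.
Qed.

End ComplexDerivative.

(** * Mean values and the minimum principle *)


Section MeanValue.
Context {R : realType}.
Local Notation C := (Cplane R).

(** [goursat] integrates the real part vertically and the imaginary part horizontally; continuity of
    these slices supplies the primitives. *)
Lemma continuous_ReIm_slice (F : C -> C) (x y : R) :
  {for (Complex x y : C), continuous F} ->
  {for y, continuous (fun t => complex.Re (F (Complex x t)))} /\
  {for x, continuous (fun s => complex.Im (F (Complex s y)))}.
Proof.
move=> /continuous_cmodP cF; split; apply/cvgrPdist_lt => e e0;
  have [d d0 hd] := cF e e0; apply/nbhs_ballP; exists d => //= t;
  rewrite /ball /= distrC => ht; rewrite distrC -raddfB.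
  apply: le_lt_trans (cmod_Re _) _; apply: hd; rewrite cmodE /=.
  by rewrite subrr expr0n add0r sqrtr_sqr.
apply: le_lt_trans (cmod_Im _) _; apply: hd; rewrite cmodE /=.
by rewrite subrr expr0n addr0 sqrtr_sqr.
Qed.

(** The mean of [Re k] over the circle of radius [r] equals its mean over a tiny circle, where
    [Re k] is close to [Re (k 0)]. Under [cexp] both circles become vertical sides of a rectangle of
    height [2 pi], to which [goursat] applies. *)
Lemma mean_value_not_lt (k : C -> C) (r rho eta : R) : 0 < r -> r < rho ->
  (forall z, cmod z < rho -> derivable k z 1) -> 0 < eta ->
  exists2 z, cmod z = r & complex.Re (k 0) - eta < complex.Re (k z).
Proof.
move=> r0 rrho dk eta0; apply: contrapT => /forall2NP bad.
have {}bad z : cmod z = r -> complex.Re (k z) <= complex.Re (k 0) - eta.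
  by move=> zr; have [//|/negP] := bad z; rewrite -leNgt.
have rho0 : 0 < rho := lt_trans r0 rrho.
have /derivable_continuous/continuous_cmodP/(_ eta eta0)[d d0 hd] :
  derivable k 0 1 by apply: dk; rewrite cmod0.
(* Radius of the tiny circle: below [r], and below [d] so that [Re k] exceeds [Re (k 0) - eta] on
   it. *)
pose q := Num.min d r / 2.
have q0 : 0 < q by rewrite divr_gt0// lt_min d0.
have qd : q < d.
  by rewrite /q ltr_pdivrMr// gt_min ltr_pMr// ltr1n.
have qr : q < r.
  by rewrite /q ltr_pdivrMr// gt_min [X in _ || X]ltr_pMr// ltr1n// orbT.
pose s1 := ln q; pose s0 := ln r; pose sg := ln rho.
have s10 : s1 < s0 by rewrite ltr_ln.
have s0g : s0 < sg by rewrite ltr_ln.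
pose F := k \o (@cexp R).
pose U s t := complex.Re (F (Complex s t)).
pose V s t := complex.Im (F (Complex s t)).
have dF s t : s < sg -> derivable F (Complex s t) 1.
  move=> hs; apply: derivable_compose; first exact: derivable_cexp.
  by apply: dk; rewrite cmod_cexp /= -(lnK rho0) ltr_expR.
have cr s t : s < sg -> CR_diff U V s t.
  by move=> hs; apply: derivable_CR; exact: dF.
have cF s t : s < sg -> {for t, continuous (U s)} /\ {for s, continuous (V^~ t)}.
  by move=> hs; apply: continuous_ReIm_slice; exact/derivable_continuous/dF.
pose p : R := pi *+ 2.
have p0 : 0 < p by rewrite mulrn_wgt0// pi_gt0.
(* The condition [x < sg] sits under the existential so that [choice] yields a total function. *)
have /choice[UP hUP] : forall x, exists G : R -> R, x < sg ->
    forall y, 0 <= y <= p -> is_derive y 1 G (U x y).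
  move=> x; have [hx|hx] := ltP x sg; last by exists id.
  have [G hG] := @exists_primitive R (U x) (-1) (p + 1)
    (fun y _ => (cF x y hx).1).
  by exists G => _ y /andP[y1 y2]; apply: hG; lra.
have /choice[VP hVP] : forall y, exists G : R -> R,
    forall x, s1 <= x <= s0 -> is_derive x 1 G (V x y).
  move=> y.
  have [|G hG] := @exists_primitive R (V^~ y) (s1 - 1) ((s0 + sg) / 2).
    by move=> x /andP[x1 x2]; apply: (cF x y _).2; lra.
  by exists G => x /andP[x1 x2]; apply: hG; lra.
have lesg x : s1 <= x <= s0 -> x < sg by move=> /andP[? ?]; lra.
have gt := @goursat R U V UP VP s1 s0 0 p (ltW s10) (ltW p0)
  (fun x y hx _ => cr x y (lesg x hx)) (fun x y hx => hUP x (lesg x hx) y)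
  (fun x y hx _ => hVP y x hx).
have s1in : s1 <= s1 <= s0 by rewrite lexx ltW.
have s0in : s1 <= s0 <= s0 by rewrite lexx ltW.
(* The horizontal sides cancel because [cexp] has period [2 pi i]; the two primitives therefore
   differ by a constant. *)
have Vper : (VP 0 s0 - VP 0 s1) - (VP p s0 - VP p s1) = 0.
  have [|c _ h] := @is_derive_MVT R (fun x => VP 0 x - VP p x) (fun=> 0) _ _ (ltW s10).
    move=> x hx; have := hVP 0 x hx; have := hVP p x hx.
    have -> : V x p = V x 0.
      by rewrite /V /F /= /cexp /= cos2pi sin2pi cos0 sin0.
    by move=> h1 h2; apply: is_derive_eq; rewrite subrr.
  by rewrite mul0r in h; lra.
(* Each vertical integral is [p] times a value of [U] on that side, so equal integrals give equal
   values at [y0] and [y1]. *)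
have [y0 _ h0] := is_derive_MVT (ltW p0) (hUP s0 (lesg s0 s0in)).
have [y1 _ h1] := is_derive_MVT (ltW p0) (hUP s1 (lesg s1 s1in)).
have hy0 : U s0 y0 <= complex.Re (k 0) - eta.
  by apply: bad; rewrite cmod_cexp /= lnK.
have hy1 : complex.Re (k 0) - eta < U s1 y1.
  have /hd : cmod (cexp (Complex s1 y1) - 0) < d.
    by rewrite subr0 cmod_cexp /= lnK.
  move=> /(le_lt_trans (cmod_Re _)); rewrite raddfB /= ltr_norml => /andP[+ _].
  by rewrite /U /F /=; lra.
have : U s1 y1 * p = U s0 y0 * p by rewrite subr0 in h0 h1; lra.
by move=> /(mulIf (lt0r_neq0 p0)); lra.
Qed.

End MeanValue.


Section MinimumPrinciple.
Context {R : realType}.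
Local Notation C := (Cplane R).

(** With [g = 1 / (f - w)] and [a = g x], the function [phi] below is the harmonic function
    [Re (conj a * g)] plus a small multiple of [|z|^2]. If the bound failed at [x], the maximum of
    [phi] on [closure U] would be interior, against the mean value property. *)
Lemma minimum_principle (f : C -> C) (U : set C) (w : C) (d : R) :
  entire f -> open U -> bounded_set U -> (forall z, U z -> f z != w) ->
  (forall z, closure U z -> ~ U z -> d <= cmod (f z - w)) ->
  forall x, U x -> d <= cmod (f x - w).
Proof.
move=> ef oU bU fw fd x Ux; rewrite leNgt; apply/negP => xd.
have fw' z : closure U z -> f z - w != 0.
  move=> cz; have [Uz|nUz] := pselect (U z); first by rewrite subr_eq0 fw.
  rewrite -cmod_gt0; apply: lt_le_trans (fd z cz nUz).
  by apply: le_lt_trans xd; exact: cmod_ge0.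
have d0 : 0 < d by apply: le_lt_trans xd; exact: cmod_ge0.
pose g (z : C) : C := (f z - w)^-1.
have dg z : closure U z -> derivable g z 1.
  move=> /fw' h; apply: derivableV => //; apply: derivableB; first exact: ef.
  exact: derivable_cst.
set a := g x.
have a0 : 0 < cmod a by rewrite cmod_gt0 invr_eq0 fw'//; exact: subset_closure.
have da : d^-1 < cmod a.
  by rewrite cmodV ltf_pV2// posrE cmod_gt0 fw'//; exact: subset_closure.
pose gam := cmod a ^+ 2 - cmod a * d^-1.
have gam0 : 0 < gam by rewrite subr_gt0 expr2 ltr_pM2l.
have [M M0 hM] := bounded_cmod_pos (closure_bounded bU).
(* On [closure U] the perturbation is then at most [gam / 2], half of the gap between the value of
   [Re (conj a * g)] at [x] and its bound on the boundary. *)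
pose eps := gam / 2 / M ^+ 2.
have eps0 : 0 < eps by rewrite !divr_gt0// exprn_gt0.
pose sq (z : C) : R := complex.Re z ^+ 2 + complex.Im z ^+ 2.
have sqE z : sq z = cmod z ^+ 2.
  by rewrite cmodE sqr_sqrtr// addr_ge0 ?sqr_ge0.
pose phi (z : C) := complex.Re (a^*%C * g z) + eps * sq z.
have cphi : {within closure U, continuous phi}.
  apply: continuous_in_subspaceT => z; rewrite inE => cz.
  have c1 : {for z, continuous (@complex.Re R \o (fun z => a^*%C * g z))}.
    apply: (@continuous_comp C C R (fun z => a^*%C * g z) (@complex.Re R) z);
      last exact: continuous_Re.
    apply: (@derivable_continuous _ (fun z => a^*%C * g z)).
    by apply: derivableM; [exact: derivable_cst|exact: dg].
  have c2 : {for z, continuous ((fun r => eps * r ^+ 2) \o @cmod R)}.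
    apply: (@continuous_comp C R R (@cmod R) (fun r => eps * r ^+ 2) z).
      exact: continuous_cmod.
    by apply: cvgM; [exact: cvg_cst|exact: exprn_continuous].
  have -> : phi = (@complex.Re R \o (fun z => a^*%C * g z)) +
                  ((fun r => eps * r ^+ 2) \o @cmod R).
    by apply/funext => y; rewrite /phi sqE.
  exact: (cvgD c1 c2).
have [|||p cp hp] := @compact_EVT_max _ _ phi (closure U).
- by exists x; exact: subset_closure.
- exact: compact_closure.
- exact: cphi.
rewrite inE in cp.
have hx : cmod a ^+ 2 <= phi p.
  apply: le_trans (hp x _); last by rewrite inE; exact: subset_closure.
  rewrite /phi -/a -sqE.
  have -> : complex.Re (a^*%C * a) = sq a.
    by rewrite /sq; case: (a) => u v /=; ring.
  by rewrite lerDl mulr_ge0 ?(ltW eps0)// sqE exprn_ge0// cmod_ge0.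
have [Up|nUp] := pselect (U p); last first.
  move: hx; apply/negP; rewrite -ltNge /phi.
  have h1 : complex.Re (a^*%C * g p) <= cmod a * d^-1.
    apply: le_trans (ler_norm _) _; apply: le_trans (cmod_Re _) _.
    rewrite cmodM ler_pM ?cmod_ge0//; first by rewrite /cmod normcJ.
    by rewrite cmodV lef_pV2 ?posrE ?cmod_gt0 ?fw'// fd.
  have h2 : eps * sq p <= gam / 2.
    rewrite sqE /eps mulrAC ler_pdivrMr ?exprn_gt0// ler_wpM2l ?divr_ge0 ?ltW//.
    by rewrite ltr_pXn2r// ?nnegrE ?cmod_ge0 ?ltW//; exact: hM.
  by rewrite /gam in h2 gam0 *; lra.
have [rho rho0 hrho] := (open_cmodP U).1 oU p Up.
(* The linear term is the harmonic part of [eps * |p + h|^2], so [phi (p + h)] is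
   [Re (k h) + eps * |h|^2] up to a constant. Taking [eta] equal to [eps * |h|^2] on the circle
   gives a value of [phi] above the maximum. *)
pose k (h : C) : C := a^*%C * g (p + h) + (2 * eps)%:C%C * p^*%C * h.
have r0 : 0 < rho / 2 by rewrite divr_gt0.
have inU h : cmod h < rho -> U (p + h).
  by move=> hh; apply: hrho; rewrite addrAC subrr add0r.
have [||||h hr] := @mean_value_not_lt R k (rho / 2) rho (eps * (rho / 2) ^+ 2).
- exact: r0.
- by rewrite ltr_pdivrMr// ltr_pMr// ltr1n.
- move=> h hh; apply: derivableD; apply: derivableM.
  + exact: derivable_cst.
  + apply: (@derivable_compose _ g (fun h => p + h)).
      by apply: derivableD; [exact: derivable_cst|exact: derivable_id].
    by apply: dg; apply: subset_closure; exact: inU.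
  + exact: derivable_cst.
  + exact: derivable_id.
- by rewrite mulr_gt0// exprn_gt0.
apply/negP; rewrite -leNgt.
have kE h' : complex.Re (k h') =
    complex.Re (a^*%C * g (p + h')) + 2 * eps * complex.Re (p^*%C * h').
  rewrite /k; move: (a^*%C * g (p + h')) (p^*%C) => [b1 b2] [p1 p2].
  by case: h' => h1 h2 /=; ring.
have hrr : cmod h < rho by rewrite hr ltr_pdivrMr// ltr_pMr// ltr1n.
have := hp (p + h); rewrite inE => /(_ (subset_closure (inU h hrr))).
rewrite !kE -hr -sqE /phi addr0 mulr0.
have -> : sq (p + h) = sq p + sq h + 2 * complex.Re (p^*%C * h).
  by rewrite /sq; case: (p) (h) => [p1 p2] [h1 h2] /=; ring.
by rewrite raddf0; lra.
Qed.

End MinimumPrinciple.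

(** * Boundaries and unbounded components *)


Section PlaneSets.
Context {R : realType}.
Local Notation C := (Cplane R).
Implicit Types (A B E K U V : set C) (z w : C).

Lemma bounded_subset A B : A `<=` B -> bounded_set B -> bounded_set A.
Proof.
move=> AB /bounded_cmodP[M h]; apply/bounded_cmodP.
by exists M => z /AB; exact: h.
Qed.

Lemma boundary_openE U : open U -> boundary U = closure U `\` U.
Proof. by move=> /interior_id h; rewrite /boundary h. Qed.

Lemma connected_sub_open A V : connected A -> open V -> A `&` V !=set0 ->
  boundary V `&` A = set0 -> A `<=` V.
Proof.
move=> cA oV AV0 bd; apply/setIidPl; apply: cA => //; first by exists V.
exists (closure V); first exact: closed_closure.
apply/seteqP; split=> z [Az Vz]; split=> //; first exact: subset_closure.
apply: contrapT => nVz; have : (boundary V `&` A) z.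
  by split=> //; rewrite boundary_openE.
by rewrite bd.
Qed.

(* For closed [E] this says that no connected component of [E] is bounded. *)
Definition no_bounded_part E := forall U, open U -> bounded_set U ->
  boundary U `&` E = set0 -> U `&` E = set0.

Lemma connected_no_bounded_part E :
  connected E -> ~ bounded_set E -> no_bounded_part E.
Proof.
move=> cE nbE U oU bU bd; apply/eqP/negPn/negP => /set0P UE.
apply: nbE; apply: bounded_subset bU; apply: connected_sub_open => //.
by rewrite setIC.
Qed.

Lemma starshaped_connected A :
  (forall z (t : R), A z -> 0 <= t <= 1 -> A (t%:C%C * z)) -> connected A.
Proof.
move=> star; have [->|/set0P[z0 Az0]] := eqVneq A set0; first exact: connected0.
have A0 : A 0.
  by have := star z0 0 Az0; rewrite lexx ler01 mul0r; apply.
pose seg z := (fun t : R => t%:C%C * z : C) @` [set` `[0, 1]].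
have -> : A = \bigcup_(z in A) seg z.
  apply/seteqP; split=> [z Az|_ [z Az [t]] + <-].
    by exists z => //; exists 1; rewrite /= ?in_itv /= ?lexx ?ler01 ?mul1r.
  by rewrite /= in_itv /=; exact: star.
apply: bigcup_connected => [|z _].
  exists 0 => z _; exists 0; last by rewrite mul0r.
  by rewrite /= in_itv /= lexx ler01.
apply: connected_continuous_connected; first exact: segment_connected.
apply: continuous_subspaceT => t B /nbhs_cmodP[e e0 eB].
pose M := cmod z + 1.
have M0 : 0 < M by rewrite ltr_wpDl ?cmod_ge0.
apply/nbhs_ballP; exists (e / M) => /=; first by rewrite divr_gt0.
move=> s; rewrite /ball /= distrC ltr_pdivlMr// => hs; apply: eB.
rewrite -mulrBl -raddfB cmodM cmod_real; apply: le_lt_trans hs.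
by rewrite ler_wpM2l// lerDl.
Qed.

Lemma connected_disc (rho : R) : connected [set z : C | cmod z < rho].
Proof.
apply: starshaped_connected => z t /= hz /andP[t0 t1].
apply: le_lt_trans hz; rewrite cmodM cmod_real ger0_norm//.
by rewrite ler_piMl ?cmod_ge0.
Qed.

Lemma connected_plane : connected [set: C].
Proof. exact: starshaped_connected. Qed.

Lemma unbounded_plane : ~ bounded_set [set: C].
Proof.
move=> /bounded_cmod_pos[M M0 /(_ M%:C%C I)].
by rewrite cmod_real ger0_norm ?ltxx// ltW.
Qed.

(** Compactness for a family of closed sets stable under intersection: a single member already
    misses [K]. *)
Lemma compact_directed K (D : set (set C)) : compact K -> D !=set0 ->
  (forall A B, D A -> D B -> D (A `&` B)) -> (forall A, D A -> closed A) ->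
  (forall z, K z -> exists2 A, D A & ~ A z) ->
  exists2 A, D A & A `&` K = set0.
Proof.
move=> cK D0 DI Dc cover.
(* The filter of ever smaller members of [D]. *)
pose F := filter_from D (fun A => [set B | D B /\ B `<=` A]).
have FF : Filter F.
  apply: filter_from_filter => // A B DA DB; exists (A `&` B); first exact: DI.
  by move=> X [DX XAB]; split; split=> // z /XAB[].
have := (compact_near_coveringP K).1 cK _ F (fun B z => D B /\ ~ B z) FF.
case=> [z Kz|A DA hA].
  have [A DA nAz] := cover z Kz.
  exists (~` A, [set B | D B /\ B `<=` A]).
    split=> /=; last by exists A.
    by apply: open_nbhs_nbhs; split=> //; rewrite openC; exact: Dc.
  by move=> [y B] [/= nAy [DB BA]]; split=> // /BA.
exists A => //; apply/seteqP; split=> // z [Az Kz].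
by have [_] := hA A (conj DA (@subset_refl _ A)) z Kz.
Qed.

Lemma compact_separation A B : compact A -> closed B -> A `&` B = set0 ->
  exists2 d : R, 0 < d & forall a b, A a -> B b -> d <= cmod (a - b).
Proof.
move=> cA cB AB.
have := (compact_near_coveringP A).1 cA _ ((0 : R)^'+)
  (fun d a => forall b, B b -> d <= cmod (a - b)) _.
case=> [a Aa|e /= e0 he].
  have : (~` B) a by move=> Ba; have : (A `&` B) a by []; rewrite AB.
  have /open_cmodP/[apply] : open (~` B) by rewrite openC.
  move=> [e e0 he]; have e20 : 0 < e / 2 by rewrite divr_gt0.
  exists ([set a' | cmod (a' - a) < e / 2], [set d | d < e / 2]).
    split=> /=; first by apply/nbhs_cmodP; exists (e / 2).
    by exists (e / 2) => //= d; rewrite /ball_ /= sub0r normrN => + d0; rewrite gtr0_norm.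
  move=> [a' d] [/= ha' hd] b Bb; rewrite leNgt; apply/negP => hlt.
  apply: (he b) => //; apply: le_lt_trans (cmod_triangle a' _ _) _.
  by rewrite cmodBC; lra.
have e20 : 0 < e / 2 by rewrite divr_gt0.
exists (e / 2) => // a b Aa; apply: he => //=.
by rewrite /ball_ /= sub0r normrN gtr0_norm// ltr_pdivrMr// ltr_pMr// ltr1n.
Qed.

(* The sets of [D] are the relatively clopen subsets of [K] containing [z]. *)
Lemma quasi_component_connected K z : compact K -> closed K -> K z ->
  let D := [set A | [/\ A `<=` K, closed A, closed (K `\` A) & A z]] in
  connected (\bigcap_(A in D) A).
Proof.
move=> cK clK Kz D; set Q := \bigcap_(A in D) A.
have DK : D K by split=> //; rewrite setDv; exact: closed0.
have DI A B : D A -> D B -> D (A `&` B).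
  move=> [A1 A2 A3 A4] [B1 B2 B3 B4]; split=> //.
  - by move=> x [/A1].
  - exact: closedI.
  - by rewrite setDIr; exact: closedU.
have clQ : closed Q by apply: closed_bigI => A [].
have QK : Q `<=` K by exact: bigcap_inf.
have Qz : Q z by move=> A [].
(* By compactness some member [A] of [D] lies in the union of disjoint neighbourhoods of [P1] and
   [P2]. Its part near [P1] is again in [D], hence contains [Q], and nothing is left for [P2]. *)
have main P1 P2 : closed P1 -> closed P2 -> P1 `&` P2 = set0 -> Q = P1 `|` P2 ->
    P1 z -> P2 = set0.
  move=> c1 c2 P12 QP P1z.
  have P1Q : P1 `<=` Q by rewrite QP; exact: subsetUl.
  have P2Q : P2 `<=` Q by rewrite QP; exact: subsetUr.
  have cP1 : compact P1.
    by apply: (subclosed_compact c1 cK); exact: subset_trans QK.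
  have [d d0 hd] := compact_separation cP1 c2 P12.
  pose nb P := [set w | exists2 x, P x & cmod (w - x) < d / 2].
  have onb P : open (nb P).
    apply/open_cmodP => w [x Px hx]; exists (d / 2 - cmod (w - x)).
      by rewrite subr_gt0.
    move=> v hv; exists x => //; apply: le_lt_trans (cmod_triangle w _ _) _; lra.
  have nb12 w : nb P1 w -> nb P2 w -> False.
    move=> [x P1x hx] [y P2y hy]; have := hd x y P1x P2y; apply/negP; rewrite -ltNge.
    by apply: le_lt_trans (cmod_triangle w _ _) _; rewrite [cmod (x - w)]cmodBC; lra.
  have nbs P : P `<=` nb P.
    by move=> x Px; exists x => //; rewrite subrr cmod0 divr_gt0.
  have cKO : compact (K `\` (nb P1 `|` nb P2)).
    apply: compact_closedI => //; rewrite closedC; exact: openU.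
  have [|A []||A DA hA] := @compact_directed _ D cKO _ DI.
  - by exists K.
  - by [].
  - move=> w [Kw nw]; apply: contrapT => /forall2NP hw; apply: nw.
    have : Q w by move=> A DA; have [//|/contrapT] := hw A.
    by rewrite QP => -[/nbs|/nbs]; [left|right].
  have [A1 A2 A3 A4] := DA.
  have AO w : A w -> nb P1 w \/ nb P2 w.
    move=> Aw; apply: contrapT => h; have : (A `&` (K `\` (nb P1 `|` nb P2))) w.
      by split=> //; split=> //; exact: A1.
    by rewrite hA.
  have E1 : A `&` nb P1 = A `&` ~` nb P2.
    apply/seteqP; split=> w [Aw h]; split=> //; first by move=> /(nb12 w h).
    by have [] := AO w Aw.
  have E2 : K `\` (A `&` nb P1) = (K `\` A) `|` (A `&` ~` nb P1).
    apply/seteqP; split=> w.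
      move=> [Kw h]; have [Aw|nAw] := pselect (A w); last by left.
      by right; split=> // h1; apply: h.
    by case=> [[Kw nAw]|[Aw h]]; split=> //; [case|exact: A1|case].
  have DB : D (A `&` nb P1).
    split; first by move=> w [/A1].
    - by rewrite E1; apply: closedI => //; rewrite closedC.
    - by rewrite E2; apply: closedU => //; apply: closedI => //; rewrite closedC.
    - by split=> //; exact: nbs.
  apply/seteqP; split=> // w P2w.
  by have [_ h1] := P2Q w P2w _ DB; case: (nb12 w h1 (nbs _ w P2w)).
move=> B B0 [G1 oG1 BG1] [C2 cC2 BC2].
have cB : closed B by rewrite BC2; exact: closedI.
have cQB : closed (Q `\` B).
  have -> : Q `\` B = Q `&` ~` G1.
    by rewrite BG1 setDIr setDv set0U.
  by apply: closedI => //; rewrite closedC.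
have BQ : B `<=` Q by rewrite BG1; exact: subIsetl.
have QE : Q = B `|` (Q `\` B) by rewrite setDUK.
have [Bz|nBz] := pselect (B z).
  rewrite QE (main B (Q `\` B)) ?setU0//.
  by apply/seteqP; split=> // w [? []].
move: B0 => /set0P/eqP; case; apply: (main (Q `\` B) B) => //.
  by apply/seteqP; split=> // w [[]].
by rewrite setUC.
Qed.

(** A bounded component lies in an open disc. Inside the closed disc the quasi-component of [z] is
    connected, so it misses the circle; so does some relatively clopen piece [A], and a thin
    neighbourhood of [A] contradicts [no_bounded_part E]. *)
Lemma unbounded_component E z : closed E -> no_bounded_part E -> E z ->
  ~ bounded_set (connected_component E z).
Proof.
move=> cE nE Ez /bounded_cmod_pos[rho rho0 hrho].
have zrho : cmod z < rho by apply: hrho; exact: connected_component_refl.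
pose K := E `&` [set w | cmod w <= rho].
have clK : closed K.
  apply: closedI => //; apply: (@closed_comp _ _ (@cmod R) [set x | x <= rho]).
    by move=> w _; exact: continuous_cmod.
  exact: closed_le.
have cK : compact K.
  apply: compact_bounded_closed => //; apply/bounded_cmodP; exists rho.
  by move=> w [].
have Kz : K z by split=> //=; exact: ltW.
pose D := [set A | [/\ A `<=` K, closed A, closed (K `\` A) & A z]].
have cQ : connected (\bigcap_(A in D) A) by exact: quasi_component_connected.
have DK : D K by split=> //; rewrite setDv; exact: closed0.
have DI A B : D A -> D B -> D (A `&` B).
  move=> [A1 A2 A3 A4] [B1 B2 B3 B4]; split=> //.
  - by move=> x [/A1].
  - exact: closedI.
  - by rewrite setDIr; exact: closedU.
have Qrho w : (\bigcap_(A in D) A) w -> cmod w < rho.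
  move=> Qw; apply: hrho; exists (\bigcap_(A in D) A) => //.
  split=> //; first by move=> A [].
  by move=> v /(_ K DK)[].
pose S := K `&` [set w | cmod w = rho].
have clS : closed S.
  apply: closedI => //; apply: (@closed_comp _ _ (@cmod R) [set x | x = rho]).
    by move=> w _; exact: continuous_cmod.
  exact: closed_eq.
have cS : compact S by apply: (subclosed_compact clS cK) => w [].
have [|A []||A DA AS] := @compact_directed _ D cS _ DI.
- by exists K.
- by [].
- move=> w [Kw hw]; apply: contrapT => /forall2NP h.
  have /Qrho : (\bigcap_(A in D) A) w.
    by move=> A DA; have [//|/contrapT] := h A.
  by rewrite hw ltxx.
have [A1 A2 A3 A4] := DA.
have Arho w : A w -> cmod w < rho.
  move=> Aw; have [Ew hw] := A1 w Aw; rewrite lt_neqAle hw andbT.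
  apply/eqP => hw'; have : (A `&` S) w by split=> //; split=> //; exact: A1.
  by rewrite AS.
have cA : compact A := subclosed_compact A2 cK A1.
have [|d d0 hd] := compact_separation cA A3.
  by apply/seteqP; split=> // w [? []].
(* A boundary point of [U] in [E] would lie in [K] outside [A], yet closer than [d] to [A]. *)
pose U := [set w | exists2 a, A a & cmod (w - a) < d / 2] `&` [set w | cmod w < rho].
have d20 : 0 < d / 2 by rewrite divr_gt0.
have oU : open U.
  apply: openI.
    apply/open_cmodP => w [x Px hx]; exists (d / 2 - cmod (w - x)).
      by rewrite subr_gt0.
    move=> v hv; exists x => //; apply: le_lt_trans (cmod_triangle w _ _) _; lra.
  apply: (@open_comp _ _ (@cmod R) [set x | x < rho]); last exact: open_lt.
  by move=> w _; exact: continuous_cmod.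
have bU : bounded_set U.
  by apply/bounded_cmodP; exists rho => w [_ /ltW].
have AU : A `<=` U.
  move=> a Aa; split; last exact: Arho.
  by exists a => //; rewrite subrr cmod0.
suff UE : U `&` E = set0.
  by have : (U `&` E) z by [split=> //; exact: AU]; rewrite UE.
apply: nE => //; rewrite boundary_openE//.
apply/seteqP; split=> // y [[cy nUy] Ey].
have yK : K y.
  split=> //=; rewrite leNgt; apply/negP => hy.
  have := (closure_cmodP U y).1 cy (cmod y - rho); rewrite subr_gt0 => /(_ hy).
  move=> [w [_ /= hw]] hwy; have := cmodD (y - w) w; rewrite subrK cmodBC; lra.
have nAy : ~ A y by move=> /AU.
have [u [[a Aa hua] _] huy] := (closure_cmodP U y).1 cy _ d20.
have := hd a y Aa (conj yK nAy); apply/negP; rewrite -ltNge.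
by apply: le_lt_trans (cmod_triangle u _ _) _; rewrite [cmod (a - u)]cmodBC; lra.
Qed.

End PlaneSets.

(** * Images under entire maps *)


Section EntireMaps.
Context {R : realType}.
Local Notation C := (Cplane R).
Implicit Types (f : C -> C) (E U X : set C) (z w : C).

Lemma entire_continuous f : entire f -> continuous f.
Proof. by move=> ef z; exact/derivable_continuous/ef. Qed.

Lemma entire_iter f n : entire f -> entire (iter n f).
Proof.
move=> ef; elim: n => [|n IH] z; first exact: derivable_id.
exact: (@derivable_compose _ f (iter n f)).
Qed.

Lemma compact_boundary U : bounded_set U -> compact (boundary U).
Proof.
move=> bU; apply: (subclosed_compact _ (compact_closure bU)) => [|z []//].
apply: closedI; first exact: closed_closure.
by rewrite closedC; exact: open_interior.
Qed.

Lemma image_boundary_closed f U : entire f -> bounded_set U ->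
  closed (f @` boundary U).
Proof.
move=> ef bU; apply: compact_closed; first exact: norm_hausdorff.
apply: continuous_compact; last exact: compact_boundary.
exact/continuous_subspaceT/entire_continuous.
Qed.

(** A form of the open mapping theorem: a value [w] near [f x] omitted on [U] stays away from the
    image of the boundary, which lies in [X], so the minimum principle keeps [f x] away from [w]. *)
Lemma image_diff_open f U X : entire f -> open U -> bounded_set U ->
  closed X -> f @` boundary U `<=` X -> open (f @` U `\` X).
Proof.
move=> ef oU bU cX UX; apply/open_cmodP => _ [[x Ux <-] nX].
have /open_cmodP/(_ _ nX)[d d0 hd] : open (~` X) by rewrite openC.
exists (d / 2) => [|w hw]; first by rewrite divr_gt0.
have nXw : ~ X w by apply: hd; lra.
split=> //; apply: contrapT => nUw.
have := @minimum_principle R f U w (d / 2) ef oU bU.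
move=> /(_ _ _ x Ux); rewrite [cmod (f x - w)]cmodBC leNgt hw => h.
suff : false by []; apply: h.
  by move=> z Uz; apply/eqP => zw; apply: nUw; exists z.
move=> z cz nUz; have Xz : X (f z).
  by apply: UX; exists z => //; rewrite boundary_openE.
rewrite leNgt; apply/negP => hz; apply: (hd (f z)) => //.
by apply: le_lt_trans (cmod_triangle w _ _) _; lra.
Qed.

Lemma image_bounded f U : entire f -> bounded_set U -> bounded_set (f @` U).
Proof.
move=> ef bU; apply: (@bounded_subset _ _ (f @` closure U)).
  by apply: image_subset; exact: subset_closure.
apply: compact_bounded_set; apply: continuous_compact; last exact: compact_closure.
exact/continuous_subspaceT/entire_continuous.
Qed.

Lemma image_diff_boundary f U X : entire f -> open U -> bounded_set U ->
  closed X -> f @` boundary U `<=` X -> boundary (f @` U `\` X) `<=` X.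
Proof.
move=> ef oU bU cX UX y; rewrite boundary_openE; last exact: image_diff_open.
move=> [cy ny]; apply: contrapT => nXy; apply: ny; split=> //.
have clf : closed (f @` closure U).
  apply: compact_closed; first exact: norm_hausdorff.
  apply: continuous_compact; last exact: compact_closure.
  exact/continuous_subspaceT/entire_continuous.
have : (f @` closure U) y.
  rewrite (closure_id (f @` closure U)).1//; apply: closureS cy.
  by move=> _ [[x Ux <-] _]; exists x => //; exact: subset_closure.
move=> [x cx xy]; exists x => //; apply: contrapT => nUx.
by apply: nXy; apply: UX; exists x => //; rewrite boundary_openE.
Qed.

(** Push [U] forward: the image of [U] minus the image of its boundary is open and bounded, and its
    boundary lies in the image of the boundary of [U], which misses [E]. *)
Lemma no_bounded_part_preimage f E :
  entire f -> no_bounded_part E -> no_bounded_part (f @^-1` E).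
Proof.
move=> ef nE U oU bU bd.
have cX := image_boundary_closed ef bU.
have VX := image_diff_boundary ef oU bU cX (@subset_refl _ _).
have XE y : (f @` boundary U) y -> ~ E y.
  by move=> [x bx <-] Ex; have : (boundary U `&` f @^-1` E) x by []; rewrite bd.
have : (f @` U `\` f @` boundary U) `&` E = set0.
  apply: nE.
  - exact: image_diff_open.
  - by apply: bounded_subset (image_bounded ef bU) => y [].
  - by apply/seteqP; split=> // y [/VX/XE].
move=> VE; apply/seteqP; split=> // x [Ux Ex].
have : ((f @` U `\` f @` boundary U) `&` E) (f x).
  by split=> //; split; [exists x|move=> /XE].
by rewrite VE.
Qed.

(** The boundary of [U] is compact, so if it misses the intersection it already misses one [E n]. *)
Lemma no_bounded_part_bigcap (E : nat -> set C) :
  (forall n, closed (E n)) -> (forall n, E n.+1 `<=` E n) ->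
  (forall n, no_bounded_part (E n)) -> no_bounded_part (\bigcap_n E n).
Proof.
move=> cE dE nE U oU bU bd.
have mE : forall n k, E (n + k)%N `<=` E n.
  move=> n; elim=> [|k IH]; first by rewrite addn0.
  by rewrite addnS; exact: subset_trans IH.
have mE' n k : (n <= k)%N -> E k `<=` E n by move=> /subnKC <-; exact: mE.
have [|A B [i _ <-] [j _ <-]|A [i _ <-]||A [n _ <-] h] :=
  @compact_directed _ _ (range E) (compact_boundary bU).
- by exists (E 0%N), 0%N.
- exists (maxn i j) => //; apply/seteqP; split=> z.
    by move=> hz; split; apply: mE' hz; rewrite ?leq_maxl// leq_maxr.
  by move=> [h1 h2]; rewrite /maxn; case: ifP.
- exact: cE.
- move=> z bz; apply: contrapT => /forall2NP h.
  have : (boundary U `&` \bigcap_n E n) z.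
    by split=> // n _; have [[]|/contrapT//] := h (E n); exists n.
  by rewrite bd.
- have : U `&` E n = set0 by apply: nE => //; rewrite setIC.
  move=> UE; apply/seteqP; split=> // z [Uz Ez].
  have : (U `&` E n) z by split=> //; exact: Ez.
  by rewrite UE.
Qed.

End EntireMaps.

(** * Growth of the iterated maximum modulus *)

Section MaximumModulus.
Context {R : realType}.
Local Notation C := (Cplane R).
Variables (f : C -> C) (r0 : R).
Hypothesis (cf : continuous f).
Hypothesis (r0_gt0 : 0 < r0).
Hypothesis (hr0 : forall r : R, r0 <= r -> r < max_modulus f r).

Lemma max_modulus_ge z : cmod (f z) <= max_modulus f (cmod z).
Proof.
apply: ub_le_sup; last by exists z.
pose S := [set w : C | cmod w = cmod z].
have cS : compact S.
  apply: compact_bounded_closed.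
    by apply/bounded_cmodP; exists (cmod z) => w /= ->.
  apply: (@closed_comp _ _ (@cmod R) [set x | x = cmod z]).
    by move=> w _; exact: continuous_cmod.
  exact: closed_eq.
have : bounded_set (f @` S).
  apply: compact_bounded_set; apply: continuous_compact cS.
  exact: continuous_subspaceT.
move=> /bounded_cmodP[M hM]; exists M => _ [w hw <-].
by apply: hM; exists w.
Qed.

Local Notation Rn n := (max_modulus_iter f n r0).

Lemma max_modulus_iterS n : Rn n.+1 = max_modulus f (Rn n).
Proof. by []. Qed.

Lemma max_modulus_iter_ge n : r0 <= Rn n.
Proof.
elim: n => [|n IH]; first exact: lexx.
by rewrite max_modulus_iterS; exact: le_trans IH (ltW (hr0 IH)).
Qed.

Lemma max_modulus_iter_ltS n : Rn n < Rn n.+1.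
Proof. by rewrite max_modulus_iterS; exact/hr0/max_modulus_iter_ge. Qed.

Lemma max_modulus_iter_mono m n : (m <= n)%N -> Rn m <= Rn n.
Proof.
move=> /subnKC <-; elim: (n - m)%N => [|k IH]; first by rewrite addn0.
by rewrite addnS; exact: le_trans IH (ltW (max_modulus_iter_ltS _)).
Qed.

(* A finite limit [L] of the increasing sequence of the [M^n(r0)] would satisfy
   [M(L) <= L]. *)
Lemma max_modulus_iter_unbounded (B : R) : exists n, B < Rn n.
Proof.
apply: contrapT => /forallNP hB.
have {}hB n : Rn n <= B by rewrite leNgt; apply/negP.
pose A := [set Rn n | n in [set: nat]].
have sA : has_sup A.
  by split; [exists (Rn 0%N), 0%N|exists B => _ [n _ <-]].
pose L := sup A.
have RL n : Rn n <= L by apply: ub_le_sup; [exact: sA.2|exists n].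
have L0 : 0 < L := lt_le_trans r0_gt0 (RL 0%N).
have [_ [z zL <-] hz] : exists2 x, [set cmod (f z) | z in [set z | cmod z = L]] x & L < x.
  apply: sup_gt; last exact: (hr0 (RL 0%N)).
  exists (cmod (f L%:C%C)), (L%:C%C) => //=.
  by rewrite cmod_real gtr0_norm.
have e0 : 0 < cmod (f z) - L by rewrite subr_gt0.
have [d d0 hd] := (continuous_cmodP f z).1 (@cf z) _ e0.
have [_ [n _ <-] hn] := sup_adherent d0 sA.
(* Radial projection of [z] to the circle of radius [Rn n]: there [|f|] is at most [Rn n.+1], hence
   at most [L], although [w] is close to [z] and [|f z|] exceeds [L]. *)
pose w : C := (Rn n / L)%:C%C * z.
have Rn0 : 0 < Rn n := lt_le_trans r0_gt0 (max_modulus_iter_ge n).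
have wn : cmod w = Rn n.
  rewrite cmodM cmod_real zL gtr0_norm ?divr_gt0// divfK// gt_eqF//.
have /hd hw : cmod (w - z) < d.
  have -> : w - z = (Rn n / L - 1)%:C%C * z by rewrite raddfB /= mulrBl mul1r.
  rewrite cmodM cmod_real zL distrC ger0_norm.
    by rewrite mulrBl mul1r divfK ?gt_eqF// -/L in hn *; lra.
  by rewrite subr_ge0 ler_pdivrMr// mul1r.
have := max_modulus_ge w; rewrite wn -max_modulus_iterS => h.
have := le_trans h (RL n.+1).
have := cmodD (f z - f w) (f w); rewrite subrK cmodBC; lra.
Qed.

End MaximumModulus.

(** * Uniform escape *)


Section UniformEscape.
Context {R : realType}.
Local Notation C := (Cplane R).
Implicit Types (f : C -> C) (K : set C).

Lemma escaping_setP f z : escaping_set f z <->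
  forall b : R, exists N, forall n, (N <= n)%N -> b <= cmod (iter n f z).
Proof.
split=> [/cvgryPge h b|h]; first by have [N _ hN] := h b; exists N.
by apply/cvgryPge => b; have [N hN] := h b; exists N.
Qed.

Lemma uniform_bound_escape f K :
  (forall b : R, exists N, forall n, (N <= n)%N ->
    forall z, K z -> b <= cmod (iter n f z)) -> escape_uniformly f K.
Proof.
move=> h; apply/cvgeyPge => b; have [N hN] := h b; exists N => //= n /hN hn.
by apply: le_ereal_inf_tmp => _ [z Kz <-]; rewrite lee_fin; exact: hn.
Qed.

Lemma escape_leaves f z (B : set C) : escaping_set f z -> bounded_set B ->
  exists N, forall n, (N <= n)%N -> ~ B (iter n f z).
Proof.
move=> /escaping_setP h /bounded_cmod_pos[M _ hM]; have [N hN] := h M.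
by exists N => n /hN le /hM; rewrite ltNge le.
Qed.

(* If all the iterates of [z] after time [N0] avoid [B 0], an orbit can be kept
   outside [B (m n)] at time [N0 + n] for some slowly growing [m]; the points
   with this property form a closed set without bounded components, because a
   point leaving that set does so through a set [X k], all of whose later
   iterates avoid the [B]'s. *)
Lemma uniform_continuum f (X B : nat -> set C) z : entire f ->
  (forall n, no_bounded_part (X n)) -> (forall n, X n.+1 `<=` X n) ->
  (forall n w, X n w -> X n.+1 (f w)) ->
  (forall n, open (B n)) -> (forall n, bounded_set (B n)) ->
  (forall n, boundary (B n) `<=` X n) -> (forall n w, X n w -> ~ B n w) ->
  (forall b : R, exists N, forall n, (N <= n)%N ->
     forall w, cmod w < b -> B n w) ->
  escaping_set f z ->
  exists K, [/\ unbounded_continuum K, K z & forall b : R, exists N,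
    forall n, (N <= n)%N -> forall w, K w -> b <= cmod (iter n f w)].
Proof.
move=> ef nX dX fX oB bB BX XB big esc.
have [N0 hN0] := escape_leaves esc (bB 0%N).
(* The index rises, by one, only when the orbit of [z] avoids the next [B] from that time on. *)
pose m := fix m i := if i is j.+1 then
  if `[< forall k, (N0 + j.+1 <= k)%N -> ~ B (m j).+1 (iter k f z) >]
  then (m j).+1 else m j else 0%N.
have mS i : (m i <= m i.+1 <= (m i).+1)%N.
  by rewrite /=; case: ifP => _; rewrite leqnn leqnSn.
have mono i j : (i <= j)%N -> (m i <= m j)%N.
  move=> /subnKC <-; elim: (j - i)%N => [|k IH]; first by rewrite addn0.
  by rewrite addnS; have /andP[h _] := mS (i + k)%N; exact: leq_trans h.
have inv i k : (N0 + i <= k)%N -> ~ B (m i) (iter k f z).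
  elim: i k => [|i IH] k; first by rewrite addn0; exact: hN0.
  rewrite /=; case: ifP => [/asboolP h /h //|_ hk]; apply: IH.
  by apply: leq_trans hk; rewrite addnS.
(* The orbit leaves the bounded set [B k.+1] for good, so [m] cannot stay at [k] forever. *)
have munb k : exists i, (k <= m i)%N.
  elim: k => [|k [i hi]]; first by exists 0%N.
  have [T hT] := escape_leaves esc (bB k.+1).
  have hk : (k <= m (maxn i T))%N by apply: leq_trans hi (mono _ _ _); exact: leq_maxl.
  have [h|h] := ltnP k (m (maxn i T)); first by exists (maxn i T).
  have E : m (maxn i T) = k by apply/eqP; rewrite eqn_leq h.
  exists (maxn i T).+1; rewrite /= E; case: ifP => // /asboolP[] l hl.
  apply: hT; apply: leq_trans hl; apply: leq_trans (leq_maxr i T) _.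
  by rewrite addnS ltnW// ltnS leq_addl.
(* The avoidance condition over [j] steps with the schedule started at [n]; the shift [n] makes the
   recursion [WS] possible. *)
pose W j n := [set u | forall i, (i < j)%N -> ~ B (m (n + i)%N) (iter i f u)].
have WS j n : W j.+1 n = ~` B (m n) `&` f @^-1` W j n.+1.
  apply/seteqP; split=> u.
    move=> h; split; first by have := h 0%N; rewrite addn0; exact.
    by move=> i hi; have := h i.+1 hi; rewrite addnS addSn iterSr.
  by move=> [h0 h] [_|i hi]; [rewrite addn0|rewrite addnS -addSn iterSr; exact: h].
have W0 n : W 0%N n = setT by apply/seteqP; split.
have cW j n : closed (W j n).
  elim: j n => [|j IH] n; first by rewrite W0; exact: closedT.
  rewrite WS; apply: closedI; first by rewrite closedC.
  by apply: closed_comp (IH _) => u _; exact: entire_continuous.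
have mX i j : (i <= j)%N -> X j `<=` X i.
  move=> /subnKC <-; elim: (j - i)%N => [|k IH]; first by rewrite addn0.
  by rewrite addnS; exact: subset_trans IH.
(* This uses that [m] grows by at most one per step, while [f] raises the index of [X] by one. *)
have XW j n : X (m n) `<=` W j n.
  elim: j n => [|j IH] n; first by rewrite W0.
  rewrite WS => u Xu; split; first exact: XB.
  apply: IH; apply: (mX _ (m n).+1); last exact: fX.
  by have /andP[] := mS n.
have nW j n : no_bounded_part (W j n).
  elim: j n => [|j IH] n.
    rewrite W0; apply: connected_no_bounded_part; first exact: connected_plane.
    exact: unbounded_plane.
  move=> U oU bU bd.
  have UX : U `&` X (m n) = set0.
    by apply: nX => //; apply/seteqP; split=> // u [bu /(XW j.+1)]; rewrite -bd.
  (* Removing [closure (B (m n))] adds to the boundary only points of the boundary of [B (m n)];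
     these lie in [X (m n)], which [U] misses. *)
  pose U' := U `\` closure (B (m n)).
  have oU' : open U'.
    by apply: openI => //; rewrite openC; exact: closed_closure.
  have bU' : bounded_set U' by apply: bounded_subset bU => u [].
  have U'W : U' `&` f @^-1` W j n.+1 = set0.
    apply: (no_bounded_part_preimage ef (IH n.+1)) => //.
    apply/seteqP; split=> // u [bu Wu]; rewrite boundary_openE// in bu.
    have [cu nu] := bu.
    have nBu : (~` B (m n)) u.
      have cB : closed (~` B (m n)) by rewrite closedC.
      rewrite ((closure_id (~` B (m n))).1 cB); apply: closureS cu => v [_ nv] Bv.
      by apply: nv; exact: subset_closure.
    have Wu' : W j.+1 n u by rewrite WS.
    have [Uu|nUu] := pselect (U u).
      suff : (U `&` X (m n)) u by rewrite UX.
      split=> //; apply: BX; rewrite boundary_openE//; split=> //.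
      by apply: contrapT => nc; apply: nu.
    suff : (boundary U `&` W j.+1 n) u by rewrite bd.
    split=> //; rewrite boundary_openE//; split=> //.
    by apply: closureS cu => v [].
  apply/seteqP; split=> // u [Uu]; rewrite WS => -[nBu Wu].
  have [cu|nu] := pselect (closure (B (m n)) u).
    suff : (U `&` X (m n)) u by rewrite UX.
    by split=> //; apply: BX; rewrite boundary_openE.
  by suff : (U' `&` f @^-1` W j n.+1) u by rewrite U'W.
pose Z := iter N0 f @^-1` (\bigcap_j W j 0%N).
have eN0 := @entire_iter _ f N0 ef.
have cZ : closed Z.
  apply: (@closed_comp _ _ (iter N0 f)); last by apply: closed_bigI => j _.
  by move=> u _; exact: entire_continuous.
have nZ : no_bounded_part Z.
  apply: no_bounded_part_preimage => //; apply: no_bounded_part_bigcap => //.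
  by move=> j u h i hi; apply: h; exact: ltnW.
have Zz : Z z.
  by move=> j _ i _; rewrite add0n -iterD; apply: inv; rewrite addnC.
exists (connected_component Z z); split.
- split; first exact: unbounded_component.
    exact: component_closed.
  exact: component_connected.
- exact: connected_component_refl.
move=> b; have [N hN] := big b; have [i hi] := munb N.
exists (N0 + i)%N => n hn w /connected_component_sub Zw.
rewrite leNgt; apply/negP => /(hN (m (n - N0)%N)) h.
have hn0 : (N0 <= n)%N by apply: leq_trans hn; exact: leq_addr.
apply: (Zw (n - N0).+1 I (n - N0)%N (ltnSn _)); rewrite add0n -iterD subnK//.
by apply: h; apply: leq_trans hi (mono _ _ _); rewrite leq_subRL.
Qed.

End UniformEscape.

(** * Consequences of the spider's web structure *)

Section SpidersWeb.
Context {R : realType}.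
Local Notation C := (Cplane R).
Variables (f : C -> C) (r0 : R).
Hypothesis (ef : entire f).
Hypothesis (r0_gt0 : 0 < r0).
Hypothesis (hr0 : forall r : R, r0 <= r -> r < max_modulus f r).

Local Notation A := (A_level f r0).
Local Notation Rn n := (max_modulus_iter f n r0).

Let cf : continuous f := entire_continuous ef.

Lemma A_level_image z : A z -> A (f z).
Proof.
move=> Az n n0; rewrite -iterSr; apply: le_trans (Az n.+1 _) => //.
exact/ltW/max_modulus_iter_ltS.
Qed.

Lemma A_level_fast n z : A (iter n f z) -> fast_escaping_set f r0 z.
Proof.
(* The delay must be positive even for [n = 0], hence [n.+1]; the spare iterate is given up by
   monotonicity of [Rn]. *)
move=> Az; exists n.+1 => // k k0; rewrite addnS -addSn iterD.
apply: le_trans (Az k.+1 _) => //.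
exact/ltW/max_modulus_iter_ltS.
Qed.

Lemma max_modulus_iter_escape (K : set C) N :
  (forall n z, (N <= n)%N -> K z -> Rn n <= cmod (iter n f z)) ->
  forall b : R, exists N, forall n, (N <= n)%N ->
    forall z, K z -> b <= cmod (iter n f z).
Proof.
move=> h b; have [k hk] := max_modulus_iter_unbounded cf r0_gt0 hr0 b.
exists (maxn N k) => n; rewrite geq_max => /andP[Nn kn] z Kz.
apply: le_trans (h n z Nn Kz); apply: le_trans (ltW hk) _.
exact: max_modulus_iter_mono.
Qed.

Variable G : nat -> set C.
Hypothesis (cA : connected A).
Hypothesis (bG : forall n, bounded_set (G n)).
Hypothesis (oG : forall n, open (G n)).
Hypothesis (G0 : G 0%N !=set0).
Hypothesis (GS : forall n, G n `<=` G n.+1).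
Hypothesis (GA : forall n, boundary (G n) `<=` A).
Hypothesis (GT : \bigcup_n G n = setT).

(** [A] is nonempty, since otherwise [G 0] would have empty boundary and fill the plane; the orbit
    of one of its points stays in [A] and escapes. *)
Lemma A_level_unbounded n : ~ bounded_set (closure (iter n f @` A)).
Proof.
have [a Aa] : A !=set0.
  apply/set0P/eqP => A0; apply: (@unbounded_plane R).
  apply: bounded_subset (bG 0%N).
  apply: connected_sub_open => //; first exact: connected_plane.
    by rewrite setTI.
  by apply/seteqP; split=> // z [/GA]; rewrite A0.
have Ai k : A (iter k f a) by elim: k => [//|k IH]; exact: A_level_image.
move=> /bounded_cmod_pos[M _ hM].
have [|N hN] := @max_modulus_iter_escape [set a] 1 _ M.
  by move=> k _ k1 ->; exact: Aa.
have : cmod (iter (n + N) f a) < M.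
  apply: hM; apply: subset_closure; exists (iter N f a) => //.
  by rewrite iterD.
by apply/negP; rewrite -leNgt; apply: hN => //; exact: leq_addl.
Qed.

Lemma disc_sub_domain (b : R) : exists n, forall w, cmod w < b -> G n w.
Proof.
have cK : compact (closure [set w : C | cmod w < b]).
  by apply: compact_closure; apply/bounded_cmodP; exists b => w /ltW.
have mG i j : (i <= j)%N -> G i `<=` G j.
  move=> /subnKC <-; elim: (j - i)%N => [|k IH]; first by rewrite addn0.
  by rewrite addnS => w /IH; exact: GS.
have [|E F [i _ <-] [j _ <-]|E [i _ <-]||E [n _ <-] h] :=
  @compact_directed _ _ (range (fun n => ~` G n)) cK.
- by exists (~` G 0%N), 0%N.
- exists (maxn i j) => //; rewrite -setCU; congr (~` _).
  apply/seteqP; split=> z; last by case; apply: mG; rewrite ?leq_maxl// leq_maxr.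
  by rewrite /maxn; case: ifP => _; [right|left].
- by rewrite closedC.
- move=> w _; have : (\bigcup_n G n) w by rewrite GT.
  by move=> [n _ Gw]; exists (~` G n) => //; exists n.
- exists n => w wb; apply: contrapT => nG.
  suff : (~` G n `&` closure [set w | cmod w < b]) w by rewrite h.
  by split=> //; exact: subset_closure.
Qed.

Lemma component_escape (K : set C) w :
  connected K -> K `<=` ~` fast_escaping_set f r0 ->
  K w -> escaping_set f w -> escape_uniformly f K.
Proof.
move=> cK Kf Kw esc; apply: uniform_bound_escape => b.
have [k hk] := disc_sub_domain b.
have [N hN] := escape_leaves esc (bG k).
exists N => n /hN nG z Kz; rewrite leNgt; apply/negP => /hk Gz.
(* One point of the image in [G k] drags the whole image inside, while the image of [w] has already
   left. *)
suff sub : iter n f @` K `<=` G k by apply: nG; apply: sub; exists w.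
apply: connected_sub_open => //.
- apply: (connected_continuous_connected cK); apply: continuous_subspaceT.
  exact: entire_continuous (@entire_iter _ f n ef).
- by exists (iter n f z); split=> //; exists z.
- apply/seteqP; split=> // y [/GA Au [u Ku uE]]; rewrite -uE in Au.
  by apply: (Kf u Ku); exact: A_level_fast Au.
Qed.

(** Later iterates factor through the zero-free one and have no zero either, so the lower bound
    [Rn k] on each boundary extends to each [G j], hence to the plane. *)
Lemma zero_free_iterate_escape n : (forall z, iter n f z != 0) ->
  forall b : R, exists N, forall k, (N <= k)%N ->
    forall z, [set: C] z -> b <= cmod (iter k f z).
Proof.
move=> nz; apply: (@max_modulus_iter_escape _ n.+1) => k z nk _.
have [j _ Gz] : (\bigcup_n G n) z by rewrite GT.
have nzk u : G j u -> iter k f u != 0.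
  by move=> _; rewrite -(subnKC (ltnW nk)) iterD; exact: nz.
have bd u : closure (G j) u -> ~ G j u -> Rn k <= cmod (iter k f u - 0).
  move=> cu nGu; rewrite subr0; have Au : A u.
    by apply: (@GA j); rewrite boundary_openE.
  by apply: Au; exact: leq_ltn_trans nk.
have := @minimum_principle R (iter k f) (G j) 0 (Rn k) (@entire_iter _ f k ef)
  (@oG j) (bG j) nzk bd z Gz.
by rewrite subr0.
Qed.

Lemma escaping_continuum z : escaping_set f z -> exists K,
  [/\ unbounded_continuum K, K z & forall b : R, exists N,
    forall n, (N <= n)%N -> forall w, K w -> b <= cmod (iter n f w)].
Proof.
move=> esc.
have [[n nz]|] := pselect (exists n, forall z, iter n f z != 0).
  exists setT; split=> //; last exact: zero_free_iterate_escape nz.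
  by split; [exact: unbounded_plane|exact: closedT|exact: connected_plane].
move=> /forallNP hz.
have /choice[p hp] : forall n, exists p, iter n f p = 0.
  by move=> n; have /existsNP[p /negP] := hz n; rewrite negbK => /eqP; exists p.
have /choice[k hk] : forall n, exists k, G k (p n).
  move=> n; have [j _ Gj] : (\bigcup_n G n) (p n) by rewrite GT.
  by exists j.
pose X n := closure (iter n f @` A).
pose B n := iter n f @` G (k n) `\` X n.
have cX n : closed (X n) by exact: closed_closure.
have GX n : iter n f @` boundary (G (k n)) `<=` X n.
  by apply: subset_trans (@subset_closure _ _); apply: image_subset; exact: GA.
have ei n := @entire_iter _ f n ef.
(* Stated for [f w] because [A_level] constrains only positive iterates and says nothing about
   [iter 0 f]. *)
have Xlow n w : X n w -> Rn n.+1 <= cmod (f w).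
  have cE : closed (f @^-1` (@cmod R @^-1` [set x | Rn n.+1 <= x])).
    apply: closed_comp; first by move=> u _; exact: cf.
    apply: closed_comp; first by move=> u _; exact: continuous_cmod.
    exact: closed_ge.
  move=> Xw; suff : (f @^-1` (@cmod R @^-1` [set x | Rn n.+1 <= x])) w by [].
  rewrite ((closure_id _).1 cE); apply: closureS Xw => _ [u Au <-] /=.
  exact: (Au n.+1 isT).
apply: (@uniform_continuum R f X B z ef _ _ _ _ _ _ _ _ esc).
- move=> n; apply: connected_no_bounded_part; last exact: A_level_unbounded.
  apply: connected_closure; apply: (connected_continuous_connected cA).
  exact: continuous_subspaceT (entire_continuous (ei n)).
- move=> n; apply: closureS => _ [u Au <-].
  by exists (f u); [exact: A_level_image|rewrite -iterSr].
- move=> n w Xw; have cE : closed (f @^-1` X n.+1).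
    by apply: closed_comp; [move=> u _; exact: cf|exact: cX].
  suff : (f @^-1` X n.+1) w by [].
  rewrite ((closure_id _).1 cE); apply: closureS Xw => _ [u Au <-].
  by apply: subset_closure; exists u.
- by move=> n; exact: image_diff_open (ei n) (@oG _) (bG _) (cX n) (GX n).
- by move=> n; apply: bounded_subset (image_bounded (ei n) (bG (k n))) => w [].
- by move=> n; exact: image_diff_boundary (ei n) (@oG _) (bG _) (cX n) (GX n).
- by move=> n w Xw [].
move=> b.
(* Once [Rn n.+1] exceeds [M], the disc of radius [b] misses [X n] by [Xlow]. *)
have /bounded_cmod_pos[M _ hM] : bounded_set (f @` [set w | cmod w < b]).
  by apply: image_bounded => //; apply/bounded_cmodP; exists b => w /ltW.
have [N hN] := max_modulus_iter_unbounded cf r0_gt0 hr0 M.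
exists N => n Nn w wb.
have XD u : X n u -> cmod u < b -> False.
  move=> /Xlow h ub; have : cmod (f u) < M by apply: hM; exists u.
  apply/negP; rewrite -leNgt; apply: le_trans h; apply: le_trans (ltW hN) _.
  by apply: max_modulus_iter_mono => //; exact: leqW.
have b0 : 0 < b by apply: le_lt_trans wb; exact: cmod_ge0.
(* The disc is connected, misses the boundary of [B n], and meets [B n] at 0, the image of the zero
   [p n]. *)
suff sub : [set w | cmod w < b] `<=` B n by exact: sub.
apply: connected_sub_open.
- exact: connected_disc.
- exact: image_diff_open (ei n) (@oG _) (bG _) (cX n) (GX n).
- exists 0; rewrite /= cmod0; split=> //; split; first by exists (p n).
  by move=> X0; apply: (XD 0) => //; rewrite cmod0.
- by apply/seteqP; split=> // u [/(image_diff_boundary (ei n) (@oG _) (bG _) (cX n) (GX n))/XD].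
Qed.

End SpidersWeb.

Theorem theorem1p7 (R : realType) (f : Cplane R -> Cplane R) (r0 : R)
  (hf : transcendental_entire f)
  (r0_gt0 : 0 < r0)
  (hr0 : forall r : R, r0 <= r -> r < max_modulus f r)
  (hweb : spiders_web (A_level f r0)) :
  (forall z, escaping_set f z ->
     exists C : set (Cplane R),
       [/\ unbounded_continuum C, C z, C `<=` escaping_set f
         & escape_uniformly f C])
  /\
  (forall K : set (Cplane R), component_of (~` fast_escaping_set f r0) K ->
     K `&` escaping_set f = set0 \/ escape_uniformly f K).
Proof.
have [ef _] := hf; have [cA [G [hG GS GA GT]]] := hweb.
have bG n := (hG n).1.
have oG n : open (G n) by have [_ [[]]] := hG n.
have G0 : G 0%N !=set0 by have [_ [[]]] := hG 0%N.
split.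
  move=> z esc.
  have [K [uK Kz unif]] :=
    escaping_continuum ef r0_gt0 hr0 cA bG oG G0 GA GT esc.
  exists K; split=> //; last exact: uniform_bound_escape.
  by move=> w Kw; apply/escaping_setP => b; have [N hN] := unif b;
    exists N => n /hN; exact.
move=> K [z nz ->].
have [->|/set0P[w [Kw esc]]] :=
  eqVneq (connected_component (~` fast_escaping_set f r0) z `&` escaping_set f) set0.
  by left.
right; apply: (component_escape ef hr0 bG oG GS GA GT _ _ Kw esc).
- exact: component_connected.
- exact: connected_component_sub.
Qed.
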